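(* Let $q\in\mathbb N_1$, $\theta>0$ and let $\nu$ be a Borel probability measure on $\Delta^{q-1}$. Then $\mathscr E^\bullet_{\theta,\nu}=(\mathscr E^n_{\theta,\nu})_{n\ge0}$ is a $q$-chromatic partition structure represented by the polychromatic Poisson–Dirichlet measure $\Pi_{\theta,\nu}$, i.e. $$\mathscr E^n_{\theta,\nu}[A]=\int_{\boldsymbol\nabla^{(q)}_0}\psi_A(\mathbf x)\,d\Pi_{\theta,\nu}(\mathbf x),\qquad A\in\mathcal A^{(q)}_n,\ n\in\mathbb N_0 .$$
   Context: Notation: $\mathbb N_1=\{1,2,\dots\}$, $\mathbb N_0=\{0,1,\dots\}$, $[q]=\{1,\dots,q\}$, $\mathbb N^q_*=\mathbb N_0^q\setminus\{\mathbf 0\}$, $0^0=1$; $|\mathbf a|=\sum_j|a_j|$, $\mathbf a!=\prod_ja_j!$, $\mathbf x^{\mathbf a}=\prod_jx_j^{a_j}$, $\binom{|\mathbf a|}{\mathbf a}=|\mathbf a|!/\mathbf a!$; $\mathbf e_j$ canonical basis vectors; $\langle\theta\rangle_n=\theta(\theta+1)\cdots(\theta+n-1)$; $\Delta^{q-1}=\{\mathbf u\in[0,1]^q:|\mathbf u|=1\}$; $m_{\mathbf a}(\nu)=\int\mathbf u^{\mathbf a}d\nu(\mathbf u)$. A $q$-chromatic partition of $n$ is a finitely supported map $A\colon\mathbb N^q_*\to\mathbb N_0$ with $\sum_{\mathbf a}A(\mathbf a)|\mathbf a|=n$; $\mathcal A^{(q)}_n$ is the set of these ($\mathcal A^{(q)}_0=\{0\}$);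 $\mathbf 1_{\mathbf a}$ is the multiset with single element $\mathbf a$; operations, $\le$ pointwise; $s(A)=\sum_{\mathbf a} A(\mathbf a)$. A $q$-chromatic partition structure is a sequence $(P_n)_{n\ge0}$ of probability measures on $\mathcal A^{(q)}_n$ with $P_{n-1}[B]=\sum_{A\in\mathcal A^{(q)}_n}P_n[A]S_{n-1,n}(A,B)$, $n\ge1$, where $S_{n-1,n}(A,B)=a_jA(\mathbf a)/n$ if $B=A_{\setminus\mathbf a,j}$ for some $\mathbf a\in\mathrm{supp}A$, $a_j\ge1$, and $0$ otherwise; $A_{\setminus\mathbf a,j}=A-\mathbf 1_{\mathbf a}$ if $\mathbf a=\mathbf e_j$, else $A-\mathbf 1_{\mathbf a}+\mathbf 1_{\mathbf a-\mathbf e_j}$. pESF: $\mathscr E^n_{\theta,\nu}[A]=\frac{n!}{\langle\theta\rangle_n}\prod_{\mathbf a\in\mathrm{supp}A}\frac1{A(\mathbf a)!}\big(\frac{\theta}{|\mathbf a|}\binom{|\mathbf a|}{\mathbf a}m_{\mathbf a}(\nu)\big)^{A(\mathbf a)}$, $A\in\mathcal A^{(q)}_n$. Kingman simplex: $\mathbf s<_{\mathrm{sl}}\mathbf t$ iff $(|\mathbf s|,s_1,\dots,s_q)<(|\mathbf t|,t_1,\dots,t_q)$ lexicographically. $\boldsymbol\nabla^{(q)}_0$ is the set of sequences $\mathbf x=(\mathbf x_i)_{i\ge0}$ in $[0,\infty)^q$ with $\mathbf x_i\ge_{\mathrm{sl}}\mathbf x_{i+1}$ for $i\ge1$, $\sum_{i\ge0}|\mathbf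 x_i|=1$, with the Borel $\sigma$-algebra of the product topology. For $A\in\mathcal A^{(q)}_n$ let $(\mathbf a_h)_{h\in[s(A)]}$ list all $\mathbf a\in\mathrm{supp}A$ with multiplicity $A(\mathbf a)$, decreasingly in shortlex order; $T_r$ is the set of injective maps $[r]\to\mathbb N_1$ ($T_0=\{\varnothing\}$). $\varphi_0\equiv1$, $\varphi_A(\mathbf x)=n!\big(\prod_{\mathbf a\in\mathrm{supp}A}\frac1{\mathbf a!^{A(\mathbf a)}A(\mathbf a)!}\big)\sum_{\iota\in T_{s(A)}}\prod_{h=1}^{s(A)}\mathbf x_{\iota(h)}^{\mathbf a_h}$; with $\mathrm{dust}(\mathbf m)=\sum_jm_j\mathbf 1_{\mathbf e_j}$: $\psi_0\equiv1$, $\psi_A(\mathbf x)=n!\sum_{\mathbf m\in\mathbb N_0^q,\,\mathrm{dust}(\mathbf m)\le A}\frac{\mathbf x_0^{\mathbf m}}{\mathbf m!(n-|\mathbf m|)!}\varphi_{A-\mathrm{dust}(\mathbf m)}(\mathbf x)$. $\Pi_{\theta,\nu}$ is the law on $\boldsymbol\nabla^{(q)}_0$ of $(\mathbf x_0,\mathbf x_1,\dots)$ with $\mathbf x_0=\mathbf 0$ and $\mathbf x_i=\ell_i\mathbf p_i$, $i\ge1$, where $\ell_1\geq\ell_2\geq\cdots$ is distributed according to the Poisson–Dirichlet distribution with parameter $\theta$ (the law of the decreasing rearrangement of $V_1,(1-V_1)V_2,(1-V_1)(1-V_2)V_3,\dots$ with $V_i$ i.i.d. Beta$(1,\theta)$;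 a.s. strictly decreasing with $\sum_i\ell_i=1$), and $(\mathbf p_i)_{i\ge1}$ are i.i.d. with law $\nu$, independent of $(\ell_i)_i$. *)

(* Defs.v *)
From HB Require Import structures.
From mathcomp Require Import all_boot all_order all_algebra.
From mathcomp Require Import finmap multiset.
From mathcomp Require Import all_classical all_reals all_analysis.

Set Implicit Arguments.
Unset Strict Implicit.
Unset Printing Implicit Defensive.

Import Order.TTheory GRing.Theory Num.Theory.
Import numFieldNormedType.Exports.

Local Open Scope classical_set_scope.
Local Open Scope ring_scope.

(** * Multi-indices and the shortlex order *)

Notation mindex q := {ffun 'I_q -> nat}.

Section MultiIndex.
Variable q : nat.
Implicit Types a : mindex q.

Definition mabs a : nat := \sum_(j < q) a j.

Definition mfact a : nat := \prod_(j < q) (a j)`!.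

Definition mzero : mindex q := [ffun=> 0%N].

Definition mdelta (j : 'I_q) : mindex q := [ffun k => (k == j : nat)].

Definition mpred a (j : 'I_q) : mindex q := [ffun k => (a k - (k == j))%N].

Definition msl_key a : seqlexi nat := mabs a :: [seq a j | j <- enum 'I_q].

Definition msl_le a b : bool := (msl_key a <= msl_key b)%O.

End MultiIndex.

Section Vectors.
Variables (R : realType) (q : nat).
Implicit Types x u : 'rV[R]_q.

Definition vabs x : R := \sum_(j < q) `|x 0 j|.

Definition monom x (a : mindex q) : R := \prod_(j < q) x 0 j ^+ a j.

Definition vsl_key x : seqlexi R := vabs x :: [seq x 0 j | j <- enum 'I_q].

Definition vsl_le x y : bool := (vsl_key x <= vsl_key y)%O.

Definition simplex : set 'rV[R]_q :=
  [set u : 'rV[R]_q | (forall j, 0 <= u 0 j <= 1) /\ vabs u = 1].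

End Vectors.

(** * Chromatic partitions: finite multisets of nonzero multi-indices *)

Notation mindex_mset q := {mset mindex q}%mset.

Section ChromaticPartitions.
Variable q : nat.
Local Open Scope mset_scope.
Implicit Types A B : mindex_mset q.

Definition weight A : nat := \sum_(a <- finsupp A) A a * mabs a.

Definition chromatic (n : nat) : set (mindex_mset q) :=
  [set A : mindex_mset q | A (mzero q) = 0%N /\ weight A = n].

(* [A_{\ a, j}]: one element of colour [j] is removed from a block of type
   [a]. *)
Definition mset_remove A (a : mindex q) (j : 'I_q) : mindex_mset q :=
  if a == mdelta j then A `\` [mset a]
  else (A `\` [mset a]) `+` [mset mpred a j].

Definition dust (m : mindex q) : mindex_mset q :=
  \big[msetD/mset0]_(j < q) msetn (m j) (mdelta j).

(* The elements of [A] with multiplicity, decreasing for shortlex. *)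
Definition listing A : seq (mindex q) :=
  sort (fun a b => msl_le b a) (enum_mset A).

End ChromaticPartitions.

Section PartitionStructures.
Variables (R : realType) (q : nat).
Local Open Scope mset_scope.

(* The pair [(a, j)] with [B = A_{\ a, j}] is unique when it exists, so that
   the value does not depend on the one chosen by [pick]. *)
Definition removal_kernel (n : nat) (A B : mindex_mset q) : R :=
  if [pick aj : finsupp A * 'I_q |
        (0 < val aj.1 aj.2)%N && (B == mset_remove A (val aj.1) aj.2)]
  is Some aj then (val aj.1 aj.2 * A (val aj.1))%:R / n%:R else 0.

(* [P n] is the mass function on the finite set [chromatic n]; its values
   elsewhere are irrelevant. *)
Definition partition_structure (P : nat -> mindex_mset q -> R) : Prop :=
  (forall n A, chromatic n A -> 0 <= P n A) /\
  (forall n, \sum_(A \in @chromatic q n) P n A = 1) /\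
  (forall n B, (1 <= n)%N -> chromatic n.-1 B ->
     P n.-1 B = \sum_(A \in @chromatic q n) P n A * removal_kernel n A B).

End PartitionStructures.

(** * Borel spaces of vectors and sequences *)

Notation borel T := (g_sigma_algebraType (@open T)).

(* Sequences with the Borel sigma-algebra of the product topology. *)
Notation seq_space T := (borel (prod_topology (fun _ : nat => T))).

(** * The polychromatic Ewens sampling formula *)

Section Ewens.
Variables (R : realType) (q : nat) (theta : R)
  (nu : probability (borel 'rV[R]_q) R).

Definition moment (a : mindex q) : R := \int[nu]_(u in @simplex R q) monom u a.

Definition rising (n : nat) : R := \prod_(i < n) (theta + i%:R).

Definition pESF (n : nat) (A : mindex_mset q) : R :=
  (n`!)%:R / rising n *
  \prod_(a <- finsupp A)
    (((A a)`!)%:R^-1 *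
     (theta / (mabs a)%:R * (((mabs a)`!)%:R / (mfact a)%:R) * moment a)
       ^+ A a).

End Ewens.

(** * Kingman simplex and the functions representing partition structures *)

Section Kingman.
Variables (R : realType) (q : nat).
Implicit Types (x : nat -> 'rV[R]_q) (A : mindex_mset q).

Definition nabla : set (nat -> 'rV[R]_q) :=
  [set x : nat -> 'rV[R]_q | [/\ forall i j, 0 <= x i 0 j,
               forall i, (1 <= i)%N -> vsl_le (x i.+1) (x i) &
               (\sum_(0 <= i <oo) (vabs (x i))%:E = 1)%E]].

(* Injective maps from [r] elements to the positive integers. *)
Definition Tinj (r : nat) : set {ffun 'I_r -> nat} :=
  [set f | injective f /\ forall h, (1 <= f h)%N].

(* For [A] empty both [phi] and [psi] evaluate to [1], through the unique map
   with empty domain. *)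
Definition phi A x : \bar R :=
  ((((weight A)`!)%:R *
    \prod_(a <- finsupp A) (((mfact a)%:R ^+ A a * ((A a)`!)%:R)^-1))%:E *
   (\esum_(f in @Tinj (size (listing A)))
      (\prod_(h < size (listing A))
         monom (x (f h)) (nth (mzero q) (listing A) h))%:E))%E.

Definition psi A x : \bar R :=
  ((((weight A)`!)%:R)%:E *
   \sum_(m \in [set m : mindex q | msubset (dust m) A])
     ((monom (x 0%N) m
       / ((mfact m)%:R * ((weight A - mabs m)`!)%:R))%:E
      * phi (msetB A (dust m)) x))%E.

(* A measure on the Kingman simplex is taken on the space of all sequences and
   integrated over [nabla]; the case [n = 0] forces [Pi nabla = 1]. *)
Definition represented_by (P : nat -> mindex_mset q -> R)
    (Pi : probability (seq_space 'rV[R]_q) R) : Prop :=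
  forall n A, chromatic n A -> ((P n A)%:E = \int[Pi]_(x in nabla) psi A x)%E.

End Kingman.

(** * The polychromatic Poisson-Dirichlet measure *)

Section Independence.
Context {R : realType} {d d1 d2} {Omega : measurableType d}
  {T1 : measurableType d1} {T2 : measurableType d2}.
Variable P : probability Omega R.

Definition mutually_independent (X : nat -> Omega -> T1) : Prop :=
  forall (J : {fset nat}) (B : nat -> set T1),
    (forall i, i \in J -> measurable (B i)) ->
    P (\bigcap_(i in [set` J]) (X i @^-1` B i)) =
    (\prod_(i <- J) P (X i @^-1` B i))%E.

Definition independent2 (X : Omega -> T1) (Y : Omega -> T2) : Prop :=
  forall B C, measurable B -> measurable C ->
    P (X @^-1` B `&` Y @^-1` C) = (P (X @^-1` B) * P (Y @^-1` C))%E.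

Definition has_law (X : Omega -> T1) (mu : set T1 -> \bar R) : Prop :=
  forall B, measurable B -> P (X @^-1` B) = mu B.

End Independence.

Section PoissonDirichlet.
Variable R : realType.

Definition beta_kernel (a b x : R) : R := x `^ (a - 1) * (1 - x) `^ (b - 1).

(* The library's beta distribution only has natural number parameters. *)
Definition beta_law (a b : R) (B : set (measurableTypeR R)) : \bar R :=
  (\int[lebesgue_measure]_(x in B `&` `[0%R, 1%R])
     (beta_kernel a b x /
      (\int[lebesgue_measure]_(y in `[0%R, 1%R]) beta_kernel a b y)%R)%:E)%E.

Definition stick_breaking (v : nat -> R) (i : nat) : R :=
  v i * \prod_(j < i) (1 - v j).

Definition decreasing_rearrangement (w l : nat -> R) : Prop :=
  nonincreasing_seq l /\ exists2 s : nat -> nat, bijective s & l =1 w \o s.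

(* The Poisson-Dirichlet sequence is indexed from [0]. *)
Definition poisson_dirichlet (theta : R) (mu : set (seq_space R) -> \bar R)
    : Prop :=
  exists (d : measure_display) (Omega : measurableType d)
    (P : probability Omega R) (V : nat -> {RV P >-> measurableTypeR R})
    (L : {RV P >-> seq_space R}),
  [/\ forall i, has_law P (V i) (beta_law 1 theta),
      mutually_independent P (fun i w => V i w),
      {ae P, forall w,
         decreasing_rearrangement (stick_breaking (fun i => V i w)) (L w)} &
      has_law P L mu].

Definition polychromatic_sequence (q : nat) (l : nat -> R)
    (p : nat -> 'rV[R]_q) (i : nat) : 'rV[R]_q :=
  if i is k.+1 then l k *: p k else 0.

(* [Pi] is the law of [X], which lies in [nabla] almost surely only: ties in
   [L w] or [L w] not summing to [1] occur with probability zero. *)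
Definition polychromatic_PD (q : nat) (theta : R)
    (nu : probability (borel 'rV[R]_q) R)
    (Pi : probability (seq_space 'rV[R]_q) R) : Prop :=
  exists (d : measure_display) (Omega : measurableType d)
    (P : probability Omega R) (L : {RV P >-> seq_space R})
    (p : {RV P >-> seq_space 'rV[R]_q}) (X : {RV P >-> seq_space 'rV[R]_q}),
  [/\ poisson_dirichlet theta (distribution P L),
      (forall i, has_law P (fun w => p w i : borel 'rV[R]_q) nu) /\
      mutually_independent P (fun i w => p w i : borel 'rV[R]_q),
      independent2 P L p,
      forall w, X w = polychromatic_sequence (L w) (p w) &
      has_law P X Pi].

End PoissonDirichlet.

(* Main.v *)
Require Import Defs.
From HB Require Import structures.
From mathcomp Require Import all_boot all_order all_algebra.
From mathcomp Require Import finmap multiset.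
From mathcomp Require Import all_classical all_reals all_analysis.
From mathcomp Require Import measurable_realfun.
From mathcomp Require Import lra.
(** Consistency. Up to the factor [n! / <theta>_n], the sampling formula is the
    joint mass of independent Poisson numbers of blocks of type [a], with means
    [w a = theta / |a| * binomial(|a|; a) * m_a(nu)]. Adding an element of colour
    [j] to a block of type [b] changes at most two of these numbers, so the mass
    received by a partition [B] from all its one-element extensions only involves
    the sums over [j] of [(b_j + 1) w (b + e_j)]. Because the coordinates of a
    point of the simplex sum to [1], the moments of [b + e_j] sum over [j] to the
    moment of [b], and these sums equal [|b| w b] for [b <> 0] and [theta] for
    [b = 0], which stands for a new block. The total is [theta + n], the ratio of
    two consecutive rising factorials ([sampling_formula_consistent]). Since the
    removal of an element is a Markov kernel, the total mass does not depend on
    [n], and it is [1] for [n = 0].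

    Representation. Under the polychromatic Poisson-Dirichlet law there is no
    dust, so [psi] reduces to [phi], a sum over injective maps [f] from the blocks
    to the indices. Its terms split into a product of powers of the sizes [l] and a
    product of monomials in the colours [p]. Sizes and colours are independent, and
    the colours at distinct indices are independent, so the colours contribute
    the product of the moments of [nu], whatever [f] is ([expectation_colours]).
    There remains the expectation of the sum over [f] of the products
    [l (f h) ^ n_h]. It is insensitive to the order of the sequence and can be
    computed for the stick-breaking sequence itself. Its value
    [theta ^ r * \prod_h (n_h - 1)! / <theta>_n] is found by conditioning on the
    first stick: either it serves no block, or exactly one block [h], and what is
    left is a scaled copy of the sequence. The resulting recursion
    ([inj_sumS]) is solved by the stated value because of the beta moments
    ([block_moment_rec]), and it determines the sum as the limit of its
    truncations to the first [N] sticks ([cvg_inj_sum]).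

    Finally, the random sequence lies in the Kingman simplex almost surely. The
    total mass of the sticks is at most [1] and has expectation [1], which is the
    case of one block of size one. No two sticks have the same length, because a tie
    would force a beta variable, whose law has no atoms, to equal a function of
    independent variables ([ae_stick_inj]); hence the ranked lengths are strictly
    decreasing and determine the shortlex order. *)

Set Implicit Arguments.
Unset Strict Implicit.
Unset Printing Implicit Defensive.

Import Order.TTheory GRing.Theory Num.Theory.
Import numFieldNormedType.Exports.
Import Defs.
Local Open Scope classical_set_scope.
Local Open Scope ring_scope.

(** * Moving one element between blocks *)

Section Moves.
Variable q : nat.
Local Open Scope mset_scope.
Implicit Types (A B C : mindex_mset q) (a b : mindex q) (j : 'I_q).

Definition msucc b j : mindex q := [ffun k => (b k + (k == j))%N].

Lemma mpred_msucc b j : mpred (msucc b j) j = b.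
Proof. by apply/ffunP => k; rewrite !ffunE addnK. Qed.

Lemma msucc_mpred a j : (0 < a j)%N -> msucc (mpred a j) j = a.
Proof.
move=> aj; apply/ffunP => k; rewrite !ffunE.
by case: eqP => [->|_]; rewrite ?subn0 ?addn0// subnK.
Qed.

Lemma msucc0 j : msucc (mzero q) j = mdelta j.
Proof. by apply/ffunP => k; rewrite !ffunE. Qed.

Lemma msucc_inj j : injective (fun x => msucc x j).
Proof. by move=> a b /(congr1 (fun x => mpred x j)); rewrite /= !mpred_msucc. Qed.

Lemma msucc_gt0 b j : (0 < msucc b j j)%N.
Proof. by rewrite ffunE eqxx addn1. Qed.

Lemma msucc_neq0 b j : msucc b j != mzero q.
Proof. by apply: contraTneq (msucc_gt0 b j) => ->; rewrite ffunE. Qed.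

Lemma msucc_neq b j : msucc b j != b.
Proof.
by apply/eqP => /ffunP /(_ j); rewrite ffunE eqxx addn1 => /eqP; rewrite eqn_leq ltnn.
Qed.

Lemma mabs_msucc b j : mabs (msucc b j) = (mabs b).+1.
Proof.
rewrite /mabs; under eq_bigr do rewrite ffunE; rewrite big_split/=.
by rewrite [X in (_ + X)%N](bigD1 j)//= eqxx [X in (_ + (_ + X))%N]big1 ?addn0 ?addn1// => k /negPf ->.
Qed.

Lemma mabs0 : mabs (mzero q) = 0%N.
Proof. by rewrite /mabs big1// => k _; rewrite ffunE. Qed.

Lemma mabs_eq0 a : (mabs a == 0%N) = (a == mzero q).
Proof.
apply/idP/eqP => [|->]; last by rewrite mabs0.
rewrite sum_nat_eq0 => /forallP h; apply/ffunP => k; rewrite ffunE.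
exact/eqP/h.
Qed.

Lemma mfact_msucc b j : mfact (msucc b j) = ((b j).+1 * mfact b)%N.
Proof.
rewrite /mfact (bigD1 j)//= [in RHS](bigD1 j)//= ffunE eqxx addn1 factS mulnA.
by congr (_ * _)%N; apply: eq_bigr => k /negPf kj; rewrite ffunE kj addn0.
Qed.

(** Adding a copy of [a] changes a single factor of a product over the blocks. The
    old factor is moved to the other side because a monoid has no division. *)
Lemma big_finsupp_add1 (T : Type) (idx : T) (op : Monoid.com_law idx)
    (F : mindex q -> nat -> T) C a : (forall x, F x 0%N = idx) ->
  op (F a (C a)) (\big[op/idx]_(x <- finsupp (C `+` [mset a]))
                    F x ((C `+` [mset a]) x)) =
  op (F a (C a).+1) (\big[op/idx]_(x <- finsupp C) F x (C x)).
Proof.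
move=> F0; pose S := (a |` finsupp C)%fset.
have widen (D : mindex_mset q) : {subset finsupp D <= S} ->
    \big[op/idx]_(x <- finsupp D) F x (D x) = \big[op/idx]_(x <- S) F x (D x).
  move=> sub; transitivity (\big[op/idx]_(x \in [set: mindex q]) F x (D x)).
    by apply/esym/fsbigTE => x xS; rewrite fsfun_dflt ?F0.
  by apply: fsbigTE => x xS; rewrite fsfun_dflt ?F0//; apply: contra xS => /sub.
rewrite !widen; last 2 first.
- by move=> x; rewrite !inE => ->; rewrite orbT.
- by move=> x; rewrite !msuppE in_msetD in_mset1 !inE msuppE orbC.
rewrite [in LHS](big_fsetD1 a) ?fset1U1//= [in RHS](big_fsetD1 a) ?fset1U1//=.
rewrite Monoid.mulmCA msetE2 msetnxx addn1; congr (op _ (op _ _)).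
rewrite big_seq_cond [RHS]big_seq_cond; apply: eq_bigr => x.
rewrite !inE andbT => /andP[/negPf xa _].
by rewrite msetE2 msetnE xa addn0.
Qed.

Lemma weight_add1 C a : weight (C `+` [mset a]) = (weight C + mabs a)%N.
Proof.
have := @big_finsupp_add1 _ _ addn (fun x m => m * mabs x)%N C a (fun=> erefl).
by rewrite /= mulSn -/(weight C) -addnA addnCA => /addnI; rewrite addnC.
Qed.

(** A block that has lost its last element is no longer a block. *)
Definition mset_place C b : mindex_mset q :=
  if b == mzero q then C else C `+` [mset b].

(** The value [b = 0] stands for a new block, which takes nothing out of [B]. *)
Definition mset_drop B b : mindex_mset q :=
  if b == mzero q then B else B `\` [mset b].

Definition mset_insert B b j : mindex_mset q :=
  mset_drop B b `+` [mset msucc b j].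

Lemma mset_removeE A a j : (0 < a j)%N ->
  mset_remove A a j = mset_place (A `\` [mset a]) (mpred a j).
Proof.
move=> aj; rewrite /mset_remove /mset_place.
suff -> : (a == mdelta j) = (mpred a j == mzero q) by [].
apply/eqP/eqP => [->|/(congr1 (fun x => msucc x j))]; last first.
  by rewrite msucc_mpred// msucc0.
by rewrite -msucc0 mpred_msucc.
Qed.

Lemma mset_insertK B b j : b == mzero q \/ b \in finsupp B ->
  mset_remove (mset_insert B b j) (msucc b j) j = B.
Proof.
move=> bB; rewrite mset_removeE ?msucc_gt0// mpred_msucc /mset_insert.
rewrite msetDC msetD1K /mset_drop /mset_place.
case: ifPn bB => [-> //|b0 [|bB]]; rewrite ?(negPf b0)//.
by rewrite msetDC msetB1K// -msuppE.
Qed.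

Lemma mset_removeK A a j : A (mzero q) = 0%N -> a \in finsupp A -> (0 < a j)%N ->
  let B := mset_remove A a j in let b := mpred a j in
  (b == mzero q \/ b \in finsupp B) /\ A = mset_insert B b j.
Proof.
move=> A0 aA aj /=; rewrite mset_removeE// /mset_place /mset_insert /mset_drop.
rewrite msucc_mpred//; case: ifPn => b0.
  by split; [left|rewrite msetDC msetB1K// -msuppE].
split; first by right; rewrite msuppE msetDC mset1D1.
rewrite [X in X `\` _]msetDC msetD1K msetDC msetB1K//.
by rewrite -msuppE.
Qed.

(** At [a] the result has lost one copy, and at any other nonzero index it has
    not: the block that was touched, hence the move, can be read off. *)
Lemma mset_remove_inj A a j a' j' : a \in finsupp A -> a' \in finsupp A ->
  (0 < a j)%N -> (0 < a' j')%N ->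
  mset_remove A a j = mset_remove A a' j' -> a = a' /\ j = j'.
Proof.
move=> aA a'A aj a'j'; rewrite !mset_removeE//.
have aa' : mset_place (A `\` [mset a]) (mpred a j) =
    mset_place (A `\` [mset a']) (mpred a' j') -> a = a'.
  move=> /msetP /(_ a); apply: contraPeq => aa'.
  have A0 : (0 < A a)%N by rewrite mset_gt0 -msuppE.
  rewrite /mset_place; set u := if _ then _ else _; set v := if _ then _ else _.
  have ua : u a = (A a).-1.
    have na : (a == mpred a j) = false.
      by apply/negbTE; rewrite -{1}(msucc_mpred aj) msucc_neq.
    by rewrite /u; case: ifP => _; rewrite !msetE2 !msetnE eqxx ?na ?addn0 subn1.
  have va : (A a <= v a)%N.
    rewrite /v; case: ifP => _; rewrite !msetE2 !msetnE (negPf aa') subn0//.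
    exact: leq_addr.
  by rewrite ua => uv; move: va; rewrite -uv leqNgt prednK// leqnn.
move=> h; have {}aa' := aa' h; split=> //; move: h; rewrite -aa' in a'j' *.
move=> h; have : mpred a j = mpred a j'.
  move: h; rewrite /mset_place.
  case: ifPn => [/eqP ->|n0]; case: ifPn => [/eqP ->//|n0'].
  - by move=> /esym/msetP /(_ (mpred a j')); rewrite msetE2 msetnxx addn1 => /eqP; rewrite eqn_leq ltnn.
  - by move=> /msetP /(_ (mpred a j)); rewrite msetE2 msetnxx addn1 => /eqP; rewrite eqn_leq ltnn.
  - move=> /msetP /(_ (mpred a j)); rewrite !msetE2 msetnxx !msetnE.
    by case: (mpred a j =P mpred a j') => // _ /eqP; rewrite addn0 addn1 eqn_leq ltnn.
move=> /ffunP /(_ j); rewrite !ffunE eqxx.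
by case: eqP => // _; rewrite subn0 subn1 => /eqP; rewrite -(prednK aj)/= eqn_leq ltnn andbF.
Qed.

Lemma mset_insert_inj B b j b' j' : b == mzero q \/ b \in finsupp B ->
  b' == mzero q \/ b' \in finsupp B ->
  mset_insert B b j = mset_insert B b' j' -> b = b' /\ j = j'.
Proof.
move=> hb hb' e.
have sB c k : msucc c k \in finsupp (mset_insert B c k).
  by rewrite msuppE /mset_insert msetDC mset1D1.
have [] := @mset_remove_inj (mset_insert B b j) (msucc b j) j (msucc b' j') j'.
- exact: sB.
- by rewrite e sB.
- exact: msucc_gt0.
- exact: msucc_gt0.
- by rewrite mset_insertK// e mset_insertK.
by move=> /[swap] -> /msucc_inj ->.
Qed.

Lemma weight_insert B b j : b == mzero q \/ b \in finsupp B ->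
  weight (mset_insert B b j) = (weight B).+1.
Proof.
move=> bB; rewrite /mset_insert weight_add1 mabs_msucc addnS /mset_drop.
case: ifPn bB => [/eqP -> _|b0 [//|bB]]; first by rewrite mabs0 addn0.
by rewrite -weight_add1 msetDC msetB1K// -msuppE.
Qed.

Lemma chromatic_insert n B b j : b == mzero q \/ b \in finsupp B ->
  chromatic n B -> chromatic n.+1 (mset_insert B b j).
Proof.
move=> bB [B0 Bn]; split; last by rewrite weight_insert// Bn.
rewrite /mset_insert msetE2 msetnE eq_sym (negPf (msucc_neq0 _ _)) addn0.
by rewrite /mset_drop; case: ifP => // _; rewrite msetE2 B0.
Qed.

Lemma chromatic_remove n A a j : a \in finsupp A -> (0 < a j)%N ->
  chromatic n.+1 A -> chromatic n (mset_remove A a j).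
Proof.
move=> aA aj [A0 An]; have [bB AE] := mset_removeK A0 aA aj; split.
  rewrite mset_removeE// /mset_place; case: ifPn => [_|b0].
    by rewrite msetE2 A0.
  by rewrite !msetE2 A0 sub0n msetnE eq_sym (negPf b0).
by apply/succn_inj; rewrite -An [in RHS]AE weight_insert.
Qed.

Definition extensions B : seq (mindex_mset q) :=
  [seq mset_insert B b j | b <- mzero q :: finsupp B, j <- enum 'I_q].

Definition removals A : seq (mindex q * 'I_q) :=
  [seq aj : mindex q * 'I_q <- [seq (a, j) | a <- finsupp A, j <- enum 'I_q] | (0 < aj.1 aj.2)%N].

Lemma mem_removals A aj :
  (aj \in removals A) = (aj.1 \in finsupp A) && (0 < aj.1 aj.2)%N.
Proof.
rewrite mem_filter andbC; congr (_ && _); apply/allpairsP/idP => [[[a j] /=]|].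
  by move=> [aA _ ->].
by case: aj => a j /= aA; exists (a, j); split=> //=; rewrite mem_enum.
Qed.

Lemma mem_extensions B A : A \in extensions B ->
  exists b j, [/\ (b == mzero q \/ b \in finsupp B) & A = mset_insert B b j].
Proof.
move=> /allpairsP[[b j] /= [+ _ ->]]; rewrite inE => /orP h.
by exists b, j.
Qed.

Lemma extensions_uniq B : B (mzero q) = 0%N -> uniq (extensions B).
Proof.
move=> B0; apply: allpairs_uniq.
- by rewrite /= fset_uniq andbT mem_finsupp B0.
- exact: enum_uniq.
move=> [b j] [b' j'] /allpairsP[[c k] [hc _ [-> ->]]].
move=> /allpairsP[[c' k'] [hc' _ [-> ->]]].
move: hc hc'; rewrite /= !inE => /orP hc /orP hc'.
by move=> /(mset_insert_inj hc hc')[-> ->].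
Qed.

Lemma chromatic_extension n A : chromatic n.+1 A ->
  exists2 B, chromatic n B & A \in extensions B.
Proof.
move=> cA; have [A0 An] := cA.
have [a aA a0] : exists2 a, a \in finsupp A & (0 < mabs a)%N.
  apply: contrapT => /forall2NP h; move: An; rewrite /weight big_seq big1// => a aA.
  have [//|/negP] := h a; rewrite -leqNgt leqn0 => /eqP ->.
  by rewrite muln0.
have [j aj] : exists j, (0 < a j)%N.
  apply/not_existsP => h; move: a0; rewrite lt0n mabs_eq0 => /eqP; apply.
  by apply/ffunP => k; rewrite ffunE; apply/eqP; rewrite -leqn0 leqNgt; apply/negP.
have [bB AE] := mset_removeK A0 aA aj.
exists (mset_remove A a j); first exact: chromatic_remove.
apply/allpairsP; exists (mpred a j, j); split => //; last by rewrite mem_enum.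
by rewrite inE; apply/orP.
Qed.

Lemma chromatic0E : @chromatic q 0 = [set mset0].
Proof.
apply/seteqP; split => [A [A0]|_ ->]; last first.
  by split; rewrite ?mset0E// /weight finsupp0 big_seq_fset0.
move=> /eqP; rewrite /weight sum_nat_seq_eq0 => /allP h.
apply/msetP => a; rewrite mset0E; apply/eqP; rewrite mset_eq0 -msuppE.
apply/negP => aA; move: (h a aA); rewrite /= muln_eq0 mabs_eq0.
by case/orP => [|/eqP a0]; move: aA; rewrite mem_finsupp ?a0 ?A0// => /negPf ->.
Qed.

(** Partitions are reached one element at a time, with finitely many choices. *)
Lemma finite_chromatic n : finite_set (@chromatic q n).
Proof.
elim: n => [|n IHn]; first by rewrite chromatic0E.
apply: (@sub_finite_set _ _ (\bigcup_(B in chromatic n) [set` extensions B])).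
  by move=> A /chromatic_extension[B nB AB]; exists B.
by apply: bigcup_finite => // B _; exact: finite_seq.
Qed.

End Moves.

Lemma fsbig_uniq_seq (R : Type) (idx : R) (op : Monoid.com_law idx)
    (T : choiceType) (A : set T) (r : seq T) (f : T -> R) : uniq r ->
  [set` r] `<=` A -> (forall i, A i -> i \notin r -> f i = idx) ->
  \big[op/idx]_(i \in A) f i = \big[op/idx]_(i <- r) f i.
Proof.
move=> ur rA f0; rewrite (fsbigE r)// big_seq_cond [RHS]big_seq.
by apply: eq_bigl => i; apply/andb_idr => /rA; rewrite inE.
Qed.

(** * Consistency of sampling formulas *)
Section Consistency.
Variables (R : realType) (q : nat).
Local Open Scope mset_scope.
Implicit Types (A B C : mindex_mset q) (a b : mindex q) (j : 'I_q).

Lemma removal_kernelE n A a j : a \in finsupp A -> (0 < a j)%N ->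
  removal_kernel R n A (mset_remove A a j) = (a j * A a)%:R / n%:R.
Proof.
move=> aA aj; rewrite /removal_kernel; case: pickP => [[a' j'] /=|].
  move=> /andP[aj' /eqP] /(mset_remove_inj aA (valP a') aj aj').
  by move=> [-> ->].
by move=> /(_ ([` aA]%fset, j)) /=; rewrite aj eqxx.
Qed.

Lemma removal_kernel_eq0 n A B : A (mzero q) = 0%N -> A \notin extensions B ->
  removal_kernel R n A B = 0.
Proof.
move=> A0; rewrite /removal_kernel; case: pickP => // -[[a aA] j] /=.
move=> /andP[aj /eqP ->] /negP[].
have [bB AE] := mset_removeK A0 aA aj.
apply/allpairsP; exists (mpred a j, j) => /=; split=> //; last by rewrite mem_enum.
by rewrite inE; apply/orP.
Qed.

Lemma removal_kernel_eq0r n A B :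
  (forall a j, (a, j) \in removals A -> B <> mset_remove A a j) ->
  removal_kernel R n A B = 0.
Proof.
move=> h; rewrite /removal_kernel; case: pickP => // -[[a aA] j] /=.
move=> /andP[aj /eqP]; have /h// : (a, j) \in removals A.
by rewrite mem_removals aA.
Qed.

(** Each of the [n + 1] elements of [A] is removed with the same probability, and
    distinct types of elements lead to distinct partitions. *)
Lemma sum_removal_kernel n A : chromatic n.+1 A ->
  \sum_(B \in @chromatic q n) removal_kernel R n.+1 A B = 1.
Proof.
move=> cA; have [A0 An] := cA.
pose rem (aj : mindex q * 'I_q) := mset_remove A aj.1 aj.2.
have uniq_rem : uniq [seq rem aj | aj <- removals A].
  rewrite map_inj_in_uniq; last first.
    move=> [a j] [a' j']; rewrite !mem_removals /= => /andP[aA aj] /andP[a'A aj'].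
    by move=> /(mset_remove_inj aA a'A aj aj')[-> ->].
  apply/filter_uniq/allpairs_uniq; [exact: fset_uniq|exact: enum_uniq|].
  by move=> [? ?] [? ?].
rewrite (@fsbig_uniq_seq _ _ _ _ _ [seq rem aj | aj <- removals A])//; last 2 first.
- move=> _ /= /mapP[[a j] + ->]; rewrite mem_removals => /andP[aA aj].
  exact: chromatic_remove.
- move=> B _ Bn; apply: removal_kernel_eq0r => a j aj BE.
  by move/negP: Bn; apply; apply/mapP; exists (a, j).
rewrite big_map big_seq.
rewrite (eq_bigr (fun aj : mindex q * 'I_q => (aj.1 aj.2 * A aj.1)%:R / n.+1%:R)); last first.
  move=> [a j]; rewrite mem_removals /= => /andP[aA aj].
  exact: removal_kernelE.
rewrite -big_seq big_filter big_mkcond big_allpairs/=.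
under eq_bigr => a _.
  rewrite (_ : \sum_(_ <- _) _ = (A a * mabs a)%:R / n.+1%:R); last first.
    rewrite big_enum/= /mabs big_distrr/= natr_sum mulr_suml.
    apply: eq_bigr => j _; case: ltnP => [_|]; first by rewrite mulnC.
    by rewrite leqn0 => /eqP ->; rewrite muln0 mul0r.
  over.
by rewrite -mulr_suml -natr_sum -/(weight A) An divff// pnatr_eq0.
Qed.

(** Up to normalization, the joint mass at [A] of independent Poisson variables
    with means [w a]. *)
Definition multinomial_weight (w : mindex q -> R) A : R :=
  \prod_(a <- finsupp A) (((A a)`!)%:R^-1 * w a ^+ A a).

Lemma multinomial_weight_add1 w C a :
  (C a).+1%:R * multinomial_weight w (C `+` [mset a]) =
  w a * multinomial_weight w C.
Proof.
pose F x m := (m`!)%:R^-1 * w x ^+ m.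
have F0 x : F x 0%N = 1 by rewrite /F fact0 invr1 expr0 mulr1.
have e : F a (C a) * multinomial_weight w (C `+` [mset a]) =
    F a (C a).+1 * multinomial_weight w C := big_finsupp_add1 *%R C a F0.
(* The common factor can be cancelled unless [w a = 0], when both sides vanish. *)
have [w0|w0] := eqVneq (w a) 0.
  rewrite w0 mul0r; apply/eqP; rewrite mulf_eq0; apply/orP; right.
  rewrite /multinomial_weight prodf_seq_eq0; apply/hasP; exists a.
    by rewrite msuppE msetDC mset1D1.
  by rewrite /= msetE2 msetnxx addn1 w0 exprS mul0r mulr0.
have c0 : F a (C a) != 0.
  by rewrite mulf_neq0 ?invr_eq0 ?pnatr_eq0 -?lt0n ?fact_gt0// expf_neq0.
have S0 : (C a).+1%:R != 0 :> R by rewrite pnatr_eq0.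
move: e; have -> : F a (C a).+1 = F a (C a) * ((C a).+1%:R^-1 * w a).
  by rewrite /F factS natrM invfM exprS mulrACA mulrC mulrACA.
rewrite -[_ * _ * multinomial_weight w C]mulrA => /(mulfI c0) ->.
by rewrite -mulrA mulVKf.
Qed.

Lemma multinomial_weight0 w : multinomial_weight w mset0 = 1.
Proof. by rewrite /multinomial_weight finsupp0 big_seq_fset0. Qed.

Variables (theta : R) (w : mindex q -> R).
Hypothesis theta_gt0 : 0 < theta.
(* These two identities make the total rate of extension of a partition of [n]
   equal to [theta + n]: [theta] for a new block and [|b|] for each block [b]. *)
Hypothesis w_delta : \sum_(j < q) w (mdelta j) = theta.
Hypothesis w_succ : forall b, b != mzero q ->
  \sum_(j < q) (b j).+1%:R * w (msucc b j) = (mabs b)%:R * w b.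

Definition sampling_formula n A : R :=
  (n`!)%:R / rising theta n * multinomial_weight w A.

Lemma rising_gt0 n : 0 < rising theta n.
Proof. by apply: prodr_gt0 => i _; rewrite ltr_pwDl// ler0n. Qed.

Lemma risingS n : rising theta n.+1 = rising theta n * (theta + n%:R).
Proof. by rewrite /rising big_ord_recr. Qed.

(** The contribution of the extensions that add an element, of any colour, to a
    block of type [b]; the case [b = 0] is a new block. *)
Let insert_block n B b : b == mzero q \/ b \in finsupp B ->
  \sum_(j < q) sampling_formula n.+1 (mset_insert B b j) *
     removal_kernel R n.+1 (mset_insert B b j) B =
  (n`!)%:R / rising theta n.+1 * multinomial_weight w B *
  (if b == mzero q then theta else (B b * mabs b)%:R).
Proof.
move=> bB; set C := mset_drop B b; pose K := (n`!)%:R / rising theta n.+1.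
transitivity (\sum_(j < q) K * multinomial_weight w C *
    ((b j).+1%:R * w (msucc b j))).
  apply: eq_bigr => j _; rewrite -[X in removal_kernel _ _ _ X](mset_insertK j bB) removal_kernelE//; last 2 first.
  - by rewrite msuppE /mset_insert msetDC mset1D1.
  - exact: msucc_gt0.
  rewrite /sampling_formula ffunE eqxx addn1 /mset_insert -/C msetE2 msetnxx addn1.
  rewrite natrM [_ * (C _).+1%:R]mulrC.
  rewrite -/K factS natrM.
  transitivity (K * (n.+1%:R / n.+1%:R) * (b j).+1%:R *
    ((C (msucc b j)).+1%:R * multinomial_weight w (C `+` [mset msucc b j]))).
    rewrite /K; move: (multinomial_weight _ _) (_.+1%:R) (_.+1%:R) (_.+1%:R^-1).
    move: (rising _ _)^-1 (n`!)%:R.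
    by move=> *; lra.
  by rewrite multinomial_weight_add1 divff ?pnatr_eq0//; lra.
rewrite -mulr_sumr -/K; rewrite /C /mset_drop; case: eqP bB => [->|/eqP b0 [//|bB]].
  move=> _; congr (_ * _); rewrite -w_delta; apply: eq_bigr => j _.
  by rewrite ffunE mul1r msucc0.
rewrite w_succ// -!mulrA; congr (_ * _).
have bE : B = (B `\` [mset b]) `+` [mset b] by rewrite msetDC msetB1K// -msuppE.
have := multinomial_weight_add1 w (B `\` [mset b]) b; rewrite -bE => h.
have Bb : (B b) = ((B `\` [mset b]) b).+1.
  by rewrite {1}bE msetE2 msetnxx addn1.
rewrite natrM {1}Bb.
move: h; move: (_.+1%:R) (multinomial_weight _ B) => m W h.
by rewrite (mulrA W) (mulrC W) h; lra.
Qed.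

(** The contributions [B b * |b|] of the blocks add up to [n] and the new block
    contributes [theta]. *)
Lemma sampling_formula_consistent n B : chromatic n B ->
  sampling_formula n B = \sum_(A \in @chromatic q n.+1)
    sampling_formula n.+1 A * removal_kernel R n.+1 A B.
Proof.
move=> cB; have [B0 Bn] := cB.
rewrite (@fsbig_uniq_seq _ _ _ _ _ (extensions B)); first last.
- by move=> A [A0 _] AB; rewrite removal_kernel_eq0 ?mulr0.
- move=> A /= /mem_extensions[b [j [bB ->]]]; exact: chromatic_insert.
- exact: extensions_uniq.
rewrite /extensions big_allpairs_dep big_cons.
rewrite big_enum/= insert_block ?eqxx; last by left.
rewrite big_seq (eq_bigr (fun b => (n`!)%:R / rising theta n.+1 *
    multinomial_weight w B * (B b * mabs b)%:R)); last first.
  move=> b bB; rewrite big_enum/= insert_block; last by right.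
  have -> // : (b == mzero q) = false.
  by apply: contraTF bB => /eqP ->; rewrite mem_finsupp B0.
rewrite -big_seq -mulr_sumr -natr_sum -/(weight B) Bn -mulrDr.
rewrite /sampling_formula risingS invfM -!mulrA; congr (_ * _).
have t0 : theta + n%:R != 0 by rewrite gt_eqF// ltr_pwDl// ler0n.
by congr (_ * _); rewrite mulrCA mulVf ?mulr1.
Qed.

(** Summing the consistency relation over [B] shows that the total mass does not
    depend on [n]. *)
Lemma sum_sampling_formula n :
  \sum_(A \in @chromatic q n) sampling_formula n A = 1.
Proof.
elim: n => [|n IHn].
  rewrite chromatic0E fsbig_set1 /sampling_formula multinomial_weight0.
  by rewrite /rising big_ord0 fact0 mulr1 divr1.
rewrite -[RHS]IHn.
rewrite [RHS](eq_fsbigr (fun B => \sum_(A \in @chromatic q n.+1)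
    sampling_formula n.+1 A * removal_kernel R n.+1 A B)); last first.
  by move=> B /set_mem cB; exact: sampling_formula_consistent.
rewrite exchange_fsbig; [|exact: finite_chromatic|exact: finite_chromatic].
apply: eq_fsbigr => A /set_mem cA.
by rewrite -mulr_fsumr sum_removal_kernel// mulr1.
Qed.

End Consistency.

(** * Laws, independence and expectations of products *)
Lemma emeasurable_prod (R : realType) d (T : measurableType d) (I : Type)
    (s : seq I) (p : pred I) (h : I -> T -> \bar R) :
  (forall i, p i -> measurable_fun setT (h i)) ->
  measurable_fun setT (fun x => \prod_(i <- s | p i) h i x)%E.
Proof.
move=> mh; elim: s => [|i s IHs].
  by under eq_fun do rewrite big_nil; exact: measurable_cst.
under eq_fun do rewrite big_cons.
by have [pi|//] := boolP (p i); apply: emeasurable_funM => //; exact: mh.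
Qed.

Section Transfer.
Local Open Scope ereal_scope.
Context {R : realType} {d} {T : measurableType d}.

(** For [y = +oo] the product could only jump when [l = 0], and then the bound
    forces [u] to vanish. *)
Lemma cvg_muleZl_ge0 (y : \bar R) (u : (\bar R)^nat) (l : \bar R) :
  0 <= y -> (forall n, 0 <= u n <= l) -> u @ \oo --> l ->
  (y * u n) @[n --> \oo] --> y * l.
Proof.
move=> y0 ul cul; have [yfin|] := boolP (y \is a fin_num); first exact: cvgeZl.
rewrite ge0_fin_numE// -leNgt leye_eq => /eqP ->.
have [l0|l0] := eqVneq l 0.
  suff -> : (fun n => +oo * u n) = cst 0 by rewrite l0 mule0; exact: cvg_cst.
  apply/funext => n; have := ul n; rewrite l0 -eq_le => /eqP <-; exact: mule0.
have {}l0 : 0 < l.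
  by rewrite lt_neqAle eq_sym l0 (le_trans _ (proj2 (andP (ul 0%N))))// (proj1 (andP (ul 0%N))).
rewrite gt0_mulye//; apply: cvg_near_cst.
have : \forall n \near \oo, 0 < u n.
  apply: (cul [set y | 0 < y]); apply: open_nbhs_nbhs; split => //.
  exact: open_ereal_gt_ereal.
by apply: filterS => n un; rewrite gt0_mulye.
Qed.

Import HBNNSimple.

Let integral_approx d1 (T1 : measurableType d1) (mu : {measure set T1 -> \bar R})
    (X : T1 -> T) (Y : T1 -> \bar R) (g : T -> \bar R)
    (mg : measurable_fun setT g) :
  measurable_fun setT X -> measurable_fun setT Y -> (forall x, 0 <= Y x) ->
  (forall t, 0 <= g t) ->
  let f := nnsfun_approx measurableT mg in
  \int[mu]_x (Y x * g (X x)) = limn (fun n => \sum_(r \in range (f n))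
    r%:E * \int[mu]_x (Y x * (\1_(f n @^-1` [set r]) (X x))%:E)).
Proof.
move=> mX mY Y0 g0 f.
have mindic n r : measurable_fun [set: T1]
    (fun x => (\1_(f n @^-1` [set r]) (X x))%:E : \bar R).
  by apply: measurableT_comp => //; apply: measurableT_comp.
have fg n t : 0 <= (f n t)%:E <= g t.
  rewrite lee_fin fun_ge0/=.
  have cf : EFin \o f^~ t @ \oo --> g t by exact: cvg_nnsfun_approx.
  rewrite -(cvg_lim _ cf)//; apply: lime_ge; first by apply/cvg_ex; exists (g t).
  by exists n => // m nm; rewrite /= lee_fin; exact/lefP/nd_nnsfun_approx.
transitivity (limn (fun n => \int[mu]_x (Y x * (f n (X x))%:E))).
  rewrite -monotone_convergence//.
  - apply: eq_integral => x _; apply/esym/cvg_lim => //.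
    by apply: cvg_muleZl_ge0 => //; exact: cvg_nnsfun_approx.
  - move=> n; apply: emeasurable_funM => //; do 2 apply: measurableT_comp => //.
  - by move=> n x _; rewrite mule_ge0// lee_fin.
  - move=> x _ m n mn; rewrite lee_pmul// ?lee_fin//.
    exact/lefP/nd_nnsfun_approx.
congr (limn _); apply/funext => n.
transitivity (\int[mu]_x \sum_(r \in range (f n))
    (Y x * (r * \1_(f n @^-1` [set r]) (X x))%:E)).
  apply: eq_integral => x _; rewrite fimfunE -fsumEFin// ge0_mule_fsumr//.
  by move=> r; rewrite EFinM nnfun_muleindic_ge0.
rewrite ge0_integral_fsum//; first last.
- by move=> r x _; rewrite mule_ge0// EFinM nnfun_muleindic_ge0.
- move=> r; apply: emeasurable_funM => //.
  by under eq_fun do rewrite EFinM; apply: measurable_funeM.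
apply: eq_fsbigr => r _.
have [r0|r0] := leP 0%R r.
  rewrite -ge0_integralZl//; first last.
  - by move=> x _; rewrite mule_ge0// lee_fin.
  - exact: emeasurable_funM.
  by apply: eq_integral => x _; rewrite EFinM muleCA.
rewrite preimage_nnfun0// indic0 !integral0_eq ?mule0//.
  by move=> x _; rewrite mule0.
by move=> x _; rewrite mulr0 mule0.
Qed.

(** By approximation with simple functions, an integral [\int Y * g(X)] only
    depends on the measure [B |-> \int Y * 1_B(X)], even when the two sides live
    on different spaces. This is used for changes of variables, for densities
    and for independence. *)
Lemma integral_transfer d1 d2 (T1 : measurableType d1) (T2 : measurableType d2)
    (mu1 : {measure set T1 -> \bar R}) (mu2 : {measure set T2 -> \bar R})
    (X1 : T1 -> T) (X2 : T2 -> T) (Y1 : T1 -> \bar R) (Y2 : T2 -> \bar R)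
    (g : T -> \bar R) :
  measurable_fun setT X1 -> measurable_fun setT X2 ->
  measurable_fun setT Y1 -> measurable_fun setT Y2 ->
  (forall x, 0 <= Y1 x) -> (forall x, 0 <= Y2 x) ->
  (forall B, measurable B -> \int[mu1]_x (Y1 x * (\1_B (X1 x))%:E) =
                             \int[mu2]_x (Y2 x * (\1_B (X2 x))%:E)) ->
  measurable_fun setT g -> (forall t, 0 <= g t) ->
  \int[mu1]_x (Y1 x * g (X1 x)) = \int[mu2]_x (Y2 x * g (X2 x)).
Proof.
move=> mX1 mX2 mY1 mY2 Y10 Y20 XY mg g0.
rewrite (integral_approx _ mg)// [RHS](integral_approx _ mg)//; congr (limn _); apply/funext => n.
by apply: eq_fsbigr => r _; rewrite XY.
Qed.

Lemma integral_indic_comp d1 (T1 : measurableType d1)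
    (mu : {measure set T1 -> \bar R}) (X : T1 -> T) B :
  measurable_fun setT X -> measurable B ->
  \int[mu]_x (\1_B (X x))%:E = mu (X @^-1` B).
Proof.
move=> mX mB; rewrite -[RHS]mul1e.
have mXB : measurable (X @^-1` B) by rewrite -[_ @^-1` _]setTI; exact: mX.
by rewrite -[in RHS](setIT (X @^-1` B)) -integral_indic// mul1e.
Qed.

Lemma integral_same_law d1 d2 (T1 : measurableType d1) (T2 : measurableType d2)
    (mu1 : {measure set T1 -> \bar R}) (mu2 : {measure set T2 -> \bar R})
    (X1 : T1 -> T) (X2 : T2 -> T) (g : T -> \bar R) :
  measurable_fun setT X1 -> measurable_fun setT X2 ->
  (forall B, measurable B -> mu1 (X1 @^-1` B) = mu2 (X2 @^-1` B)) ->
  measurable_fun setT g -> (forall t, 0 <= g t) ->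
  \int[mu1]_x g (X1 x) = \int[mu2]_x g (X2 x).
Proof.
move=> mX1 mX2 X12 mg g0.
have := @integral_transfer _ _ _ _ mu1 mu2 X1 X2 (cst 1) (cst 1) g mX1 mX2.
rewrite /cst; under eq_integral do rewrite mul1e.
under [in RHS]eq_integral do rewrite mul1e.
apply=> // B mB; under eq_integral do rewrite mul1e.
under [in RHS]eq_integral do rewrite mul1e.
by rewrite !integral_indic_comp ?X12.
Qed.

End Transfer.

Section Independence.
Local Open Scope ereal_scope.
Context {R : realType} {d} {Omega : measurableType d}.
Variable P : probability Omega R.

(** Replacing one indicator after the other by a general function reduces the
    product rule for expectations to the one for events. *)
Lemma expectation_independent2 d1 d2 (T1 : measurableType d1)
    (T2 : measurableType d2) (X : Omega -> T1) (Y : Omega -> T2)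
    (g : T1 -> \bar R) (h : T2 -> \bar R) :
  measurable_fun setT X -> measurable_fun setT Y -> independent2 P X Y ->
  measurable_fun setT g -> measurable_fun setT h ->
  (forall t, 0 <= g t) -> (forall t, 0 <= h t) ->
  \int[P]_w (g (X w) * h (Y w)) = \int[P]_w g (X w) * \int[P]_w h (Y w).
Proof.
move=> mX mY XY mg mh g0 h0.
have mgX : measurable_fun setT (g \o X) by exact: measurableT_comp.
have mhY : measurable_fun setT (h \o Y) by exact: measurableT_comp.
have mi1 B : measurable B ->
    measurable_fun setT (fun w => (\1_B (X w))%:E : \bar R).
  by move=> mB; do 2 apply: measurableT_comp => //.
have mi2 B : measurable B ->
    measurable_fun setT (fun w => (\1_B (Y w))%:E : \bar R).
  by move=> mB; do 2 apply: measurableT_comp => //.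
rewrite -ge0_integralZl//; last exact: integral_ge0.
apply: (@integral_transfer _ _ _ _ _ _ _ P P Y Y (g \o X)
  (cst (\int[P]_w g (X w)))) => //.
- by move=> w; exact: g0.
- by move=> w; rewrite /cst integral_ge0.
move=> C mC; rewrite ge0_integralZl//; last 2 first.
- exact: mi2.
- exact: integral_ge0.
rewrite muleC -ge0_integralZl//; last exact: integral_ge0.
under eq_integral do rewrite muleC.
apply: (@integral_transfer _ _ _ _ _ _ _ P P X X (fun w => (\1_C (Y w))%:E)
  (cst (\int[P]_w (\1_C (Y w))%:E))) => //.
- exact: mi2.
- by move=> w; rewrite /cst; apply: integral_ge0 => v _; rewrite lee_fin.
move=> B mB; rewrite ge0_integralZl//; last 2 first.
- exact: mi1.
- by apply: integral_ge0 => v _; rewrite lee_fin.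
rewrite !integral_indic_comp// muleC -XY//.
have mBC : measurable (X @^-1` B `&` Y @^-1` C).
  by apply: measurableI; rewrite -[_ @^-1` _]setTI; [exact: mX|exact: mY].
rewrite -[X in P X]setIT -integral_indic//.
by apply: eq_integral => w _; rewrite -EFinM mulrC indicI.
Qed.

Lemma expectation_prod_independent d1 (T1 : measurableType d1)
    (X : nat -> Omega -> T1) (g : nat -> T1 -> \bar R) N :
  (forall i, measurable_fun setT (X i)) -> mutually_independent P X ->
  (forall i, measurable_fun setT (g i)) -> (forall i t, 0 <= g i t) ->
  \int[P]_w (\prod_(i < N) g i (X i w)) = \prod_(i < N) \int[P]_w g i (X i w).
Proof.
move=> mX indX.
(* Indicators are replaced by general functions one coordinate at a time; only
   the first [k] coordinates are free of the restriction. *)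
pose indicator i (g : nat -> T1 -> \bar R) :=
  exists2 B, measurable B & g i = (fun t => (\1_B t)%:E).
suff ind k : forall g, (forall i, measurable_fun setT (g i)) ->
    (forall i t, 0 <= g i t) ->
    (forall i, (k <= i < N)%N -> indicator i g) ->
    \int[P]_w (\prod_(i < N) g i (X i w)) = \prod_(i < N) \int[P]_w g i (X i w).
  by move=> mg g0; apply: (ind N) => // i /andP[/leq_ltn_trans h /h]; rewrite ltnn.
elim: k => [|k IHk] {}g mg g0 gind.
  have [B mB gB] : exists2 B : nat -> set T1, (forall i, measurable (B i)) &
      forall i, (i < N)%N -> g i = (fun t => (\1_(B i) t)%:E).
    have /choice[B hB] : forall i, exists B : set T1, measurable B /\
        ((i < N)%N -> g i = (fun t => (\1_B t)%:E)).
      move=> i; case: (ltnP i N) => iN; last by exists set0.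
      by have [B mB ->] := gind i iN; exists B.
    by exists B => i; [exact: (hB i).1|exact: (hB i).2].
  have mXB i : measurable (X i @^-1` B i).
    by rewrite -[_ @^-1` _]setTI; exact: mX.
  have := indX [fset i | i in iota 0 N]%fset B (fun i _ => mB i).
  have -> : \bigcap_(i in [set` [fset i | i in iota 0 N]%fset]) X i @^-1` B i =
      [set w | forall i, (i < N)%N -> B i (X i w)].
    by apply/seteqP; split=> w /= h i; have := h i;
      rewrite /= !inE/= mem_iota add0n => {}h iN; exact: h.
  rewrite (_ : (\prod_(i <- _) _)%E = \prod_(i < N) P (X i @^-1` B i)); last first.
    rewrite -(big_mkord xpredT (fun i => P (X i @^-1` B i))) /index_iota subn0.
    rewrite big_imfset//=; apply: perm_big.
    by apply: uniq_perm; rewrite ?undup_uniq ?iota_uniq// => i; rewrite ?mem_undup.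
  have mE : measurable [set w | forall i, (i < N)%N -> B i (X i w)].
    rewrite (_ : mkset _ = \bigcap_(i in `I_N) (X i @^-1` B i)); last first.
      by apply/seteqP; split.
    by apply: bigcap_measurableType => i _.
  move=> E; transitivity (P [set w | forall i, (i < N)%N -> B i (X i w)]).
    rewrite -[X in P X]setIT -integral_indic//; apply: eq_integral => w _.
    rewrite (eq_bigr (fun i : 'I_N => (\1_(B i) (X i w))%:E)); last first.
      by move=> i _; rewrite gB.
    rewrite prodEFin; congr EFin; rewrite indicE.
    have [wB|wB] := pselect (forall i, (i < N)%N -> B i (X i w)).
      rewrite mem_set// big1// => i _.
      by rewrite indicE mem_set//; exact: wB.
    rewrite memNset//; move/existsNP: wB => [i /not_implyP[iN Bi]].
    by rewrite (bigD1 (Ordinal iN))//= indicE memNset// mul0r.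
  rewrite E; apply: eq_bigr => i _; rewrite gB//.
  by rewrite integral_indic_comp.
have [Nk|kN] := leqP N k.
  apply: IHk => // i /andP[/leq_ltn_trans h /h]; by rewrite ltnNge Nk.
pose k' := Ordinal kN.
pose c := \prod_(i < N | i != k') \int[P]_w g i (X i w).
have c0 : 0 <= c by apply: prode_ge0 => i _; exact: integral_ge0.
have mgX i : measurable_fun setT (fun w => g i (X i w)).
  exact: measurableT_comp.
rewrite (bigD1 k')//= -/c muleC -ge0_integralZl//.
transitivity (\int[P]_w ((\prod_(i < N | i != k') g i (X i w)) * g k (X k w))).
  by apply: eq_integral => w _; rewrite (bigD1 k')//= muleC.
apply: (@integral_transfer _ _ _ _ _ _ _ P P (X k) (X k) _ (cst c)) => //.
- by apply: emeasurable_prod => i _.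
- by move=> w; apply: prode_ge0.
move=> B mB; pose h i := if i == k then (fun t => (\1_B t)%:E) else g i.
have hg (i : 'I_N) : i != k' -> h i = g i.
  by move=> ik; rewrite /h ifN//; apply: contra ik => /eqP e; apply/eqP/val_inj.
have hk : h k = (fun t => (\1_B t)%:E) by rewrite /h eqxx.
have mh i : measurable_fun setT (h i).
  by rewrite /h; case: ifP => // _; exact: measurableT_comp.
have h0 i t : 0 <= h i t by rewrite /h; case: ifP => // _; rewrite lee_fin.
have hind i : (k <= i < N)%N -> indicator i h.
  move=> /andP[ki iN]; have [->|ik] := eqVneq i k; first by exists B.
  have [|C mC gC] := gind i; first by rewrite ltn_neqAle eq_sym ik ki.
  by exists C => //; rewrite /h (negPf ik).
have := IHk h mh h0 hind; rewrite [RHS](bigD1 k')//= hk.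
rewrite (eq_bigr (fun i : 'I_N => \int[P]_w g i (X i w))); last first.
  by move=> i ik; rewrite hg.
rewrite -/c => hE.
transitivity (\int[P]_w \prod_(i < N) h i (X i w)).
  apply: eq_integral => w _; rewrite [RHS](bigD1 k')//= hk muleC; congr (_ * _).
  by apply: eq_bigr => i ik; rewrite hg.
rewrite hE ge0_integralZl//; first by rewrite muleC.
by do 2 apply: measurableT_comp => //.
Qed.

End Independence.

(** * Unordered sums of nonnegative functions *)
Section CountableSums.
Local Open Scope ereal_scope.
Context {R : realType} {I : countType}.
Implicit Types (S : set I) (a : I -> \bar R).

(** The numbering of a countable type turns an unordered sum into a series, to which
    monotone convergence applies. *)
Let term S a (k : nat) : \bar R :=
  if (pickle_inv k : option I) is Some i then (if i \in S then a i else 0) else 0.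

Let term_ge0 S a k : (forall i, 0 <= a i) -> 0 <= term S a k.
Proof. by move=> a0; rewrite /term; case: pickle_inv => // i; case: ifP. Qed.

Let esum_term S a : (forall i, 0 <= a i) ->
  \esum_(i in S) a i = \sum_(k <oo) term S a k.
Proof.
move=> a0; rewrite nneseries_esumT; last by move=> k; exact: term_ge0.
rewrite esum_mkcond (eq_esum (b := fun i => term S a (choice.pickle i))); last first.
  by move=> i _; rewrite /term choice.pickleK_inv.
rewrite -(esum_image setT choice.pickle (term S a)); last first.
  by move=> i j _ _; exact: (pcan_inj choice.pickleK_inv).
rewrite esum_mkcond; apply: eq_esum => k _; case: ifPn => // /negP kN.
rewrite /term; case E : (pickle_inv k : option I) => [i|//]; exfalso; apply: kN.
by rewrite inE; exists i => //; have := @choice.pickle_invK I k; rewrite E.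
Qed.

Context {d} {T : measurableType d}.

Lemma measurable_esum (S : set I) (f : I -> T -> \bar R) :
  (forall i x, 0 <= f i x) -> (forall i, measurable_fun setT (f i)) ->
  measurable_fun setT (fun x => \esum_(i in S) f i x).
Proof.
move=> f0 mf; under eq_fun do rewrite esum_term//.
apply: (ge0_emeasurable_sum (P := xpredT)) => [k x _ _|k _]; first exact: term_ge0.
by rewrite /term; case: pickle_inv => // i; case: (i \in S).
Qed.

Lemma integral_esum (mu : {measure set T -> \bar R}) (S : set I)
    (f : I -> T -> \bar R) :
  (forall i x, 0 <= f i x) -> (forall i, measurable_fun setT (f i)) ->
  \int[mu]_x (\esum_(i in S) f i x) = \esum_(i in S) \int[mu]_x f i x.
Proof.
move=> f0 mf; rewrite esum_term; last by move=> i; exact: integral_ge0.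
under eq_integral do rewrite esum_term//.
rewrite integral_nneseries//.
- apply: eq_eseriesr => k _; rewrite /term; case: pickle_inv => [i|]; last exact: integral0.
  by case: (i \in S) => //; exact: integral0.
- by move=> k; rewrite /term; case: pickle_inv => // i; case: (i \in S).
- by move=> k x _; exact: term_ge0.
Qed.

Lemma esumZl (S : set I) (a : I -> \bar R) (c : R) : (0 <= c)%R ->
  (forall i, 0 <= a i) -> \esum_(i in S) (c%:E * a i) = c%:E * \esum_(i in S) a i.
Proof.
move=> c0 a0; rewrite !esum_term//; last by move=> i; rewrite mule_ge0.
rewrite -nneseriesZl//; last by move=> k _; exact: term_ge0.
apply: eq_eseriesr => k _; rewrite /term; case: pickle_inv => [i|]; rewrite ?mule0//.
by case: ifP; rewrite ?mule0.
Qed.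

End CountableSums.

(** * Moments of the beta law *)
Section BetaMoments.
Variable R : realType.
Local Notation mu := (@lebesgue_measure R).

Lemma is_derive_powR_onem (a x : R) : x < 1 ->
  is_derive x 1 (fun y : R => (1 - y) `^ a) (- (a * (1 - x) `^ (a - 1))).
Proof.
move=> x1; have x0 : 0 < 1 - x by rewrite subr_gt0.
have d1 := is_derive1_powR a x0.
have d2 : is_derive x 1 (fun y : R => 1 - y) (0 - 1) by apply: is_deriveB.
have := @is_derive1_comp _ (fun z => z `^ a) (fun y : R => 1 - y) x _ _ d1 d2.
by rewrite sub0r mulrN1.
Qed.

(** For [s < 1] the integrand is unbounded near [1], so that the antiderivative is
    first used on [[0, 1 - 1 / (n + 2)]]. *)
Lemma integral_powR_onem (s : R) : 0 < s ->
  (\int[mu]_(x in `[0%R, 1%R]) ((1 - x) `^ (s - 1))%:E = (s^-1)%:E)%E.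
Proof.
move=> s0; pose f (x : R) := (1 - x) `^ (s - 1).
pose b n : R := 1 - n.+2%:R^-1.
have b0 n : 0 < b n by rewrite subr_gt0 invf_lt1// ltr1n.
have b1 n : b n < 1 by rewrite gtrBl invr_gt0.
have mf : measurable_fun [set: R] (EFin \o f).
  apply/measurable_EFinP; apply: (measurableT_comp (measurable_powR _)).
  exact: measurable_funB.
pose F (y : R) := - s^-1 * (1 - y) `^ s.
have dF (x : R) : x < 1 -> is_derive x 1 F (f x).
  move=> x1; have d := is_derive_powR_onem s x1.
  have -> : f x = - s^-1 *: - (s * (1 - x) `^ (s - 1)).
    by rewrite /GRing.scale/= mulrNN mulKf// gt_eqF.
  exact: is_deriveZ.
have cF (x : R) : x < 1 -> {for x, continuous F}.
  by move=> /dF dFx; apply/differentiable_continuous/derivable1_diffP.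
have int_b n : (\int[mu]_(x in `[0%R, b n]) (f x)%:E =
    (s^-1)%:E - (s^-1 * n.+2%:R^-1 `^ s)%:E)%E.
  rewrite (@continuous_FTC2 _ f F)//.
  - rewrite /F subr0 powR1 mulr1 /b opprB addrCA subrr addr0.
    by rewrite -!EFinB mulNr opprK addrC.
  - apply: derivable_within_continuous => x; rewrite in_itv/= => /andP[_ xb].
    by have [] := is_derive_powR_onem (s - 1) (le_lt_trans xb (b1 n)).
  - split.
    + by move=> x; rewrite in_itv/= => /andP[_ xb]; have [] := dF x (lt_trans xb (b1 n)).
    + by apply/cvg_at_right_filter/cF; rewrite ltr01.
    + exact/cvg_at_left_filter/cF.
  - move=> x; rewrite in_itv/= => /andP[_ xb].
    by rewrite derive1E; have [_ ->] := dF x (lt_trans xb (b1 n)).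
have UE : \bigcup_n `[0, b n]%classic = `[0, 1[%classic :> set R.
  apply/seteqP; split=> [x [n _]|x]; rewrite /= !in_itv/= => /andP[x0 xb].
    by rewrite x0 (le_lt_trans xb (b1 n)).
  have x1 : 0 < 1 - x by rewrite subr_gt0.
  exists (Num.bound (1 - x)^-1) => //; rewrite /= in_itv/= x0/= /b.
  rewrite lerBrDr -lerBrDl invf_ple ?posrE//.
  rewrite (le_trans (ltW (archi_boundP _)))// ?invr_ge0 ?ltW//.
  by rewrite ltr_nat.
rewrite -integral_itv_bndo_bndc; last exact: measurable_funTS.
rewrite -UE.
have : (\int[mu]_(x in `[0%R, b n]) (f x)%:E @[n --> \oo] -->
        \int[mu]_(x in \bigcup_n `[0%R, b n]%classic) (f x)%:E)%E.
  apply: ge0_nondecreasing_set_cvg_integral => //.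
  - move=> n m nm; apply/subsetPset => x; rewrite /= !in_itv/= => /andP[-> xb]/=.
    by rewrite (le_trans xb)// lerD2l lerN2 lef_pV2// ?posrE// ler_nat !ltnS.
  - by move=> n; exact: measurable_funTS.
  - by move=> n x _; rewrite lee_fin powR_ge0.
move=> /cvg_lim <-//; apply/cvg_lim => //.
under eq_fun do rewrite int_b -EFinB.
apply: cvg_EFin; first by near=> n.
rewrite -[X in _ --> X]subr0 -[X in _ --> _ - X](mulr0 s^-1).
apply: cvgB; first exact: cvg_cst.
apply: cvgMl_tmp.
have /cvg_at_rightP := powR_cvg0 s0.
apply; split=> [n|]; first by rewrite invr_gt0.
have := @cvg_harmonic R; rewrite -(cvg_shiftn 1).
by under eq_fun do rewrite addn1.
Unshelve. all: by end_near. Qed.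

Lemma powR_pred (y s : R) : 0 <= y -> 0 < s -> y `^ s = y * y `^ (s - 1).
Proof.
move=> y0 s0; have [->|yN0] := eqVneq y 0; first by rewrite powR0 ?gt_eqF// mul0r.
by rewrite -{2}(powRr1 y0) -powRD ?yN0 ?implybT// addrC subrK.
Qed.

(** The value [B(k + 1, s)] of the beta function at an integer. *)
Definition beta_int (k : nat) (s : R) : R := (k`!)%:R / \prod_(i < k.+1) (s + i%:R).

Lemma prod_shift_gt0 (s : R) n : 0 < s -> 0 < \prod_(i < n) (s + i%:R).
Proof. by move=> s0; apply: prodr_gt0 => i _; rewrite ltr_pwDl// ler0n. Qed.

Lemma prod_shiftS (s : R) n :
  \prod_(i < n.+1) (s + i%:R) = s * \prod_(i < n) (s + 1 + i%:R).
Proof.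
rewrite big_ord_recl addr0; congr (_ * _); apply: eq_bigr => i _.
by rewrite /bump/= natrD addrA.
Qed.

(** The recursion that [1 = x + (1 - x)] imposes on the beta integrals. *)
Lemma beta_intS k s : 0 < s -> beta_int k s = beta_int k.+1 s + beta_int k (s + 1).
Proof.
move=> s0; rewrite /beta_int.
have p0 : \prod_(i < k) (s + 1 + i%:R) != 0.
  by rewrite gt_eqF// prod_shift_gt0// addr_gt0.
have a0 : s + 1 + k%:R != 0 by rewrite gt_eqF// ltr_pwDl ?ler0n// addr_gt0.
have sN0 : s != 0 by rewrite gt_eqF.
rewrite (prod_shiftS s k) (prod_shiftS s k.+1) (big_ord_recr k)/=.
rewrite factS natrM -natr1.
move: p0 a0 => /=; set p := \prod_(i < k) _; set f : R := (k`!)%:R => p0 a0.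
have -> : f / (s * p) = f * (s + 1 + k%:R) / (s * (p * (s + 1 + k%:R))).
  by rewrite mulrA -mulf_div divff// mulr1.
have -> : f / (p * (s + 1 + k%:R)) = s * f / (s * (p * (s + 1 + k%:R))).
  by rewrite -mulf_div divff// mul1r.
by rewrite -mulrDl; congr (_ / _); lra.
Qed.

Lemma integral_beta_int k s : 0 < s ->
  (\int[mu]_(x in `[0%R, 1%R]) (x ^+ k * (1 - x) `^ (s - 1))%:E
    = (beta_int k s)%:E)%E.
Proof.
elim: k s => [|k IHk] s s0.
  under eq_integral do rewrite expr0 mul1r.
  by rewrite integral_powR_onem// /beta_int fact0 big_ord1 addr0 div1r.
have mf j a : measurable_fun (`[0, 1]%classic : set R) (fun x : R => (x ^+ j * (1 - x) `^ a)%:E).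
  apply: measurable_funTS; apply/measurable_EFinP; apply: measurable_funM.
    exact: measurable_funX.
  by apply: (measurableT_comp (measurable_powR _)); exact: measurable_funB.
have f0 j a (x : R) : `[0, 1]%classic x -> (0 <= (x ^+ j * (1 - x) `^ a)%:E)%E.
  rewrite /= in_itv/= => /andP[x0 _].
  by rewrite lee_fin mulr_ge0 ?exprn_ge0 ?powR_ge0.
have s1 : 0 < s + 1 by rewrite addr_gt0.
have : ((beta_int k s)%:E =
    \int[mu]_(x in `[0%R, 1%R]) (x ^+ k.+1 * (1 - x) `^ (s - 1))%:E +
    \int[mu]_(x in `[0%R, 1%R]) (x ^+ k * (1 - x) `^ (s + 1 - 1))%:E)%E.
  rewrite -IHk// -ge0_integralD; [|by []|exact: f0|exact: mf|exact: f0|exact: mf].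
  apply: eq_integral => x; rewrite inE/= in_itv/= => /andP[x0 x1].
  rewrite -EFinD addrK (powR_pred _ s0) ?subr_ge0// exprS.
  by congr EFin; lra.
rewrite IHk// beta_intS// EFinD => /(congr1 (fun z => z - (beta_int k (s + 1))%:E)%E).
by rewrite !addeK.
Qed.

Lemma exprn_mul_powR (y s : R) n : 0 <= y -> 0 < s ->
  y ^+ n * y `^ (s - 1) = y `^ (s + n%:R - 1).
Proof.
move=> y0 s0; elim: n => [|n IHn]; first by rewrite expr0 mul1r addr0.
rewrite exprS -mulrA IHn -natr1 [in RHS]addrA [in RHS]addrK.
by rewrite [RHS]powR_pred// ltr_pwDl// ler0n.
Qed.

End BetaMoments.

Section StickMoments.
Context {R : realType} {d} {Omega : measurableType d}.
Variables (P : probability Omega R) (theta : R).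
Hypothesis theta_gt0 : 0 < theta.
Local Notation mu := (@lebesgue_measure R).

(** The moment [E V^a (1 - V)^b] for [V] of law Beta(1, theta). *)
Definition stick_moment (a b : nat) : R := theta * beta_int a (theta + b%:R).

Let density (x : R) : \bar R :=
  (theta%:E * ((fun y : R => ((1 - y) `^ (theta - 1))%R%:E) \_ `[0%R, 1%R]%classic) x)%E.

Let mpow : measurable_fun [set: R] (fun y : R => ((1 - y) `^ (theta - 1))%:E).
Proof.
apply/measurable_EFinP; apply: (measurableT_comp (measurable_powR _)).
exact: measurable_funB.
Qed.

Lemma beta_lawE (B : set R) : measurable B ->
  beta_law 1 theta B = (\int[mu]_x (density x * (\1_B x)%:E))%E.
Proof.
move=> mB; rewrite /beta_law.
have Z : \int[mu]_(y in `[0, 1]) beta_kernel 1 theta y = theta^-1.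
  rewrite -[RHS]/(fine (theta^-1)%:E) -integral_powR_onem//.
  congr fine; apply: eq_integral => y _.
  by rewrite /beta_kernel subrr powRr0 mul1r.
rewrite Z invrK integral_mkcond; apply: eq_integral => x _.
rewrite /density !patchE in_setI indicE.
case: (x \in B); case: (x \in _) => /=; rewrite ?mule0 ?mul0e ?mule1//.
by rewrite /beta_kernel subrr powRr0 mul1r mulrC EFinM.
Qed.

(** The absolute values are harmless, as the law is carried by [[0, 1]], and they make
    the integrand nonnegative everywhere. *)
Lemma expectation_stick (V : Omega -> R) a b : measurable_fun setT V ->
  has_law P (V : Omega -> measurableTypeR R) (beta_law 1 theta) ->
  (\int[P]_w (`|V w| ^+ a * `|1 - V w| ^+ b)%:E = (stick_moment a b)%:E)%E.
Proof.
move=> mV lV; pose g (x : R) : \bar R := (`|x| ^+ a * `|1 - x| ^+ b)%:E.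
have mg : measurable_fun setT g.
  apply/measurable_EFinP; apply: measurable_funM.
    by apply: measurable_funX; apply: (measurableT_comp (@normr_measurable R setT)).
  apply: measurable_funX; apply: (measurableT_comp (@normr_measurable R setT)).
  exact: measurable_funB.
have g0 x : (0 <= g x)%E by rewrite lee_fin mulr_ge0 ?exprn_ge0.
transitivity (\int[P]_w (cst 1%E w * g (V w)))%E.
  by apply: eq_integral => w _; rewrite mul1e.
rewrite (@integral_transfer _ _ _ _ _ _ _ P mu V id (cst 1%E) density g)//.
- rewrite /stick_moment EFinM -integral_beta_int; last by rewrite ltr_pwDl// ler0n.
  rewrite -ge0_integralZl//; first last.
  + by rewrite lee_fin ltW.
  + move=> x; rewrite /= in_itv/= => /andP[x0 _].
    by rewrite lee_fin mulr_ge0 ?exprn_ge0 ?powR_ge0.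
  + apply: measurable_funTS; apply/measurable_EFinP; apply: measurable_funM.
      exact: measurable_funX.
    by apply: (measurableT_comp (measurable_powR _)); exact: measurable_funB.
  rewrite [RHS]integral_mkcond; apply: eq_integral => x _.
  rewrite /density /g !patchE; case: ifPn => [|_]; last by rewrite mule0 mul0e.
  rewrite inE/= in_itv/= => /andP[x0 x1].
  rewrite !ger0_norm ?subr_ge0// -exprn_mul_powR ?subr_ge0//.
  by rewrite -!EFinM; congr EFin; lra.
- apply: measurable_funeM; apply/(measurable_restrictT _ _).1 => //.
  exact: measurable_funTS.
- move=> x; rewrite mule_ge0 ?lee_fin ?(ltW theta_gt0)//.
  by apply: erestrict_ge0 => y _; rewrite lee_fin powR_ge0.
- move=> B mB; rewrite -beta_lawE// -lV//.
  under eq_integral do rewrite mul1e.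
  exact: integral_indic_comp.
Qed.

End StickMoments.

(** * Sums over injective maps: conditioning on the first stick *)
Lemma cvg_sumr (R : realType) (I : Type) (s : seq I) (p : pred I)
    (u : I -> nat -> R) (l : I -> R) :
  (forall i, p i -> u i n @[n --> \oo] --> l i) ->
  (\sum_(i <- s | p i) u i n) @[n --> \oo] --> \sum_(i <- s | p i) l i.
Proof.
move=> ul; elim: s => [|i s IHs].
  by under eq_fun do rewrite big_nil; rewrite big_nil; exact: cvg_cst.
under eq_fun do rewrite big_cons; rewrite big_cons.
by have [pi|//] := boolP (p i); apply: cvgD => //; exact: ul.
Qed.

(* The variable [n_] gives the sizes of [r] blocks and [c a b] the moment
   [E V^a (1 - V)^b] of a stick variable. A map [f] assigns to each block [h] the
   index [f h] of a stick. *)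
Section FirstStick.
Variables (R : realType) (r : nat) (n_ : 'I_r -> nat) (c : nat -> nat -> R).
Hypothesis n_gt0 : forall h, (0 < n_ h)%N.
Hypothesis c_ge0 : forall a b, 0 <= c a b.
Hypothesis c00 : c 0 0 = 1.
Hypothesis c0_lt1 : forall b, (0 < b)%N -> c 0 b < 1.
Implicit Types (D : {set 'I_r}) (f : {ffun 'I_r -> nat}).

Definition msize D : nat := \sum_(h in D) n_ h.

(** The exponent of [V_i] in the product of the powers [W_(f h) ^ n_h] of the stick
    lengths; [part_above] is the exponent of [1 - V_i]. *)
Definition part_of D f (i : nat) : nat := \sum_(h in D | f h == i) n_ h.

Definition part_above D f (i : nat) : nat := \sum_(h in D | (i < f h)%N) n_ h.

(** The expectation of that product when the [V_i] are independent and the values of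
    [f] are below [N]. *)
Definition stick_weight N D f : R :=
  \prod_(i < N) c (part_of D f i) (part_above D f i).

(** The default value [0] outside of [D] makes these functions correspond to the
    injections of [D] into the first [N] indices. *)
Definition injections N D : set {ffun 'I_r -> nat} :=
  [set f | [/\ {in D &, injective f}, forall h, h \notin D -> f h = 0%N &
               forall h, h \in D -> (f h < N)%N]].

Definition shift D f : {ffun 'I_r -> nat} :=
  [ffun h => if h \in D then (f h).+1 else 0%N].

Lemma stick_weight_ge0 N D f : 0 <= stick_weight N D f.
Proof. exact: prodr_ge0. Qed.

Lemma stick_weight_recr N D f : (forall h, h \in D -> (f h < N)%N) ->
  stick_weight N.+1 D f = stick_weight N D f.
Proof.
move=> fN; rewrite /stick_weight big_ord_recr/= [X in c X]big1; last first.
  by move=> h /andP[hD /eqP e]; have := fN h hD; rewrite e ltnn.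
rewrite [X in c _ X]big1 ?c00 ?mulr1// => h /andP[hD e].
by have := ltn_trans (fN h hD) e; rewrite ltnn.
Qed.

Lemma part_of_shift D D' f i : D' \subset D ->
  part_of D (shift D' f) i.+1 = part_of D' f i.
Proof.
move=> /fintype.subsetP D'D; apply: eq_bigl => h; rewrite ffunE.
by have [hD'|_] := boolP (h \in D'); [rewrite D'D ?eqSS|rewrite andbF].
Qed.

Lemma part_above_shift D D' f i : D' \subset D ->
  part_above D (shift D' f) i.+1 = part_above D' f i.
Proof.
move=> /fintype.subsetP D'D; apply: eq_bigl => h; rewrite ffunE.
by have [hD'|_] := boolP (h \in D'); [rewrite D'D ?ltnS|rewrite andbF].
Qed.

Lemma stick_weight_shift N D D' f : D' \subset D ->
  stick_weight N.+1 D (shift D' f) =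
  c (msize (D :\: D')) (msize D') * stick_weight N D' f.
Proof.
move=> D'D; rewrite /stick_weight big_ord_recl; congr (c _ _ * _).
- apply: eq_bigl => h; rewrite ffunE finset.in_setD andbC.
  by case: (h \in D').
- apply: eq_bigl => h; rewrite ffunE.
  have [hD'|_] := boolP (h \in D'); last by rewrite ltnn andbF.
  by rewrite (fintype.subsetP D'D).
- by apply: eq_bigr => i _; rewrite part_of_shift// part_above_shift.
Qed.

(** The maps that use index [0] for the blocks of [D :\: D'] only, necessarily at most
    one block, are the shifts of the maps on the remaining blocks. *)
Lemma shift_bij N D D' : D' \subset D -> (#|D :\: D'| <= 1)%N ->
  set_bij (injections N D')
    (injections N.+1 D `&` [set f | D' = [set h in D | (0 < f h)%N]]) (shift D').
Proof.
move=> D'D DD'; split.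
- move=> f [finj f0 fN]; split; first split.
  + move=> h1 h2 h1D h2D; rewrite !ffunE.
    have [h1D'|h1D'] := boolP (h1 \in D'); have [h2D'|h2D'] := boolP (h2 \in D') => //.
      by move=> [] /finj; apply.
    by move=> _; apply: (card_le1_eqP DD'); rewrite finset.in_setD ?h1D' ?h2D'.
  + by move=> h hD; rewrite ffunE; case: ifPn => // /(fintype.subsetP D'D); rewrite (negPf hD).
  + by move=> h hD; rewrite ffunE; case: ifPn => // hD'; rewrite ltnS fN.
  + apply/setP => h; rewrite inE ffunE.
    have [hD'|_] := boolP (h \in D'); last by rewrite andbF.
    by rewrite (fintype.subsetP D'D).
- move=> f g /set_mem[_ f0 _] /set_mem[_ g0 _] /ffunP fg; apply/ffunP => h.
  have := fg h; rewrite !ffunE; case: ifPn => [_ []//|hD' _].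
  by rewrite f0// g0.
- move=> f [[finj f0 fN] D'E]; exists [ffun h => (f h).-1].
    split.
    + move=> h1 h2; rewrite D'E !inE !ffunE => /andP[h1D f1] /andP[h2D f2] e.
      by apply: finj => //; rewrite -(prednK f1) e prednK.
    + move=> h; rewrite ffunE D'E inE negb_and => /orP[/f0 ->//|].
      by rewrite -eqn0Ngt => /eqP ->.
    + move=> h; rewrite D'E inE ffunE => /andP[hD f1].
      by rewrite -ltnS prednK// fN.
  apply/ffunP => h; rewrite !ffunE D'E inE.
  have [hD|hD] := boolP (h \in D); last by rewrite f0.
  by have [f1|] := ltnP 0 (f h); [rewrite /= prednK|rewrite leqn0 => /eqP ->].
Qed.

Local Open Scope ereal_scope.

Definition inj_sum N D : \bar R := \esum_(f in injections N D) (stick_weight N D f)%:E.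

Lemma inj_sum_ge0 N D : 0 <= inj_sum N D.
Proof. by apply: esum_ge0 => f _; rewrite lee_fin stick_weight_ge0. Qed.

Let esum_shift N D D' : D' \subset D -> (#|D :\: D'| <= 1)%N ->
  \esum_(f in injections N.+1 D `&` [set f | D' = [set h in D | (0 < f h)%N]])
    (stick_weight N.+1 D f)%:E =
  (c (msize (D :\: D')) (msize D'))%:E * inj_sum N D'.
Proof.
move=> D'D DD'; rewrite (reindex_esum _ _ _ _ (shift_bij N D'D DD')).
under eq_esum do rewrite stick_weight_shift// EFinM.
by rewrite esumZl// => f; rewrite lee_fin stick_weight_ge0.
Qed.

(** Condition on whether the first stick is used, and if so by which block. *)
Lemma inj_sumS N D : inj_sum N.+1 D =
  (c 0 (msize D))%:E * inj_sum N D +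
  \sum_(h in D) (c (n_ h) (msize (D :\ h)))%:E * inj_sum N (D :\ h).
Proof.
pose pos f := [set h in D | (0 < f h)%N].
pose a f : \bar R := (stick_weight N.+1 D f)%:E.
have a0 f : 0 <= a f by rewrite lee_fin stick_weight_ge0.
have split_a f : injections N.+1 D f -> a f =
    (if f \in [set f | D = pos f]%classic then a f else 0) +
    \sum_(h in D) (if f \in [set f | D :\ h = pos f]%classic then a f else 0).
  move=> [finj _ _]; have [posD|posD] := eqVneq (pos f) D.
    rewrite mem_set//= big1 ?adde0// => h hD; rewrite memNset//= posD.
    by move=> /setP /(_ h); rewrite !inE eqxx hD.
  rewrite memNset ?add0e; last by move=> /= e; move: posD; rewrite -e eqxx.
  have [h0 h0D fh0] : exists2 h, h \in D & f h = 0%N.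
    apply: contrapT => /forall2NP h; move/eqP: posD; apply.
    apply/setP => k; rewrite inE; apply/andb_idr => kD.
    by rewrite lt0n; apply/eqP; have [] := h k.
  have posE : pos f = D :\ h0.
    apply/setP => k; rewrite !inE andbC; have [kD|] := boolP (k \in D); rewrite ?andbF//.
    rewrite !andbT lt0n; congr (~~ _); apply/eqP/eqP => [e|->//].
    by apply: finj => //; rewrite e fh0.
  rewrite (bigD1 h0)//= mem_set//= big1 ?adde0// => h /andP[hD hh0].
  rewrite memNset//= posE => /setP /(_ h); rewrite !inE eqxx hD hh0//.
rewrite /inj_sum (eq_esum split_a) esumD; last 2 first.
- by move=> f _; case: ifP.
- by move=> f _; apply: sume_ge0 => h _; case: ifP.
rewrite -esum_mkcondr esum_shift ?finset.setDv ?cards0//; congr (_ + _).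
  by rewrite /msize big_set0.
rewrite esum_sum; last by move=> f h _ _; case: ifP.
apply: eq_bigr => h hD; rewrite -esum_mkcondr.
have DDh : D :\: (D :\ h) = [set h]%SET.
  by apply/setP => k; rewrite !inE; case: eqP => [->|]; rewrite ?hD//; case: (k \in D).
rewrite esum_shift ?subsetDl ?DDh ?cards1//.
by rewrite /msize big_set1.
Qed.

Lemma inj_sum0 N : inj_sum N finset.set0 = 1.
Proof.
rewrite /inj_sum (_ : injections N finset.set0 = [set [ffun=> 0%N]]%classic).
  rewrite esum_set1 ?lee_fin ?stick_weight_ge0// /stick_weight big1// => i _.
  by rewrite /part_of /part_above !big_pred0// => h; rewrite inE.
apply/seteqP; split=> [f [_ f0 _]|_ ->].
  by apply/ffunP => h; rewrite ffunE f0// inE.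
split=> [h h'|h _|h]; rewrite ?inE//; by rewrite ffunE.
Qed.

(* A candidate for the limit of the truncated sums: a solution of the same
   recursion with [N] sent to infinity. *)
Hypothesis (T : {set 'I_r} -> R).
Hypothesis T_ge0 : forall D, (0 <= T D)%R.
Hypothesis T0 : T finset.set0 = 1%R.
Hypothesis T_rec : forall D, T D = (c 0 (msize D) * T D +
  \sum_(h in D) c (n_ h) (msize (D :\ h)) * T (D :\ h))%R.

Lemma inj_sum_le N D : inj_sum N D <= (T D)%:E.
Proof.
elim: N D => [|N IHN] D; last first.
  rewrite inj_sumS T_rec EFinD -sumEFin leeD//.
    by rewrite EFinM lee_wpmul2l// lee_fin.
  by apply: lee_sum => h _; rewrite EFinM lee_wpmul2l// lee_fin.
have [->|D0] := eqVneq D finset.set0; first by rewrite inj_sum0 T0.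
rewrite /inj_sum (_ : injections 0 D = set0) ?esum_set0 ?lee_fin//.
rewrite -subset0 => f [_ _ fN]; have [h hD] := set0Pn _ D0.
by have := fN h hD.
Qed.

Lemma inj_sum_fin N D : inj_sum N D \is a fin_num.
Proof. by rewrite ge0_fin_numE ?inj_sum_ge0// (le_lt_trans (inj_sum_le N D))// ltry. Qed.

Lemma inj_sum_nondecreasing D : nondecreasing_seq (fun N => inj_sum N D).
Proof.
apply/nondecreasing_seqP => N.
rewrite /inj_sum esum_mkcond [leRHS]esum_mkcond; apply: le_esum => f _.
case: ifPn => [/set_mem[finj f0 fN]|_].
  by rewrite mem_set ?stick_weight_recr//; split=> // h /fN/ltnW.
by case: ifP => // _; rewrite lee_fin stick_weight_ge0.
Qed.

(** By induction on [D], the limit [l] of the truncated sums satisfies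
    [l = c 0 (msize D) * l + y] with the same [y] as [T D]; this equation has a
    single solution as [c 0 (msize D) < 1]. *)
Lemma cvg_inj_sum D : inj_sum N D @[N --> \oo] --> (T D)%:E.
Proof.
have [m] := ubnP #|D|; elim: m D => // m IHm D; rewrite ltnS => Dm.
have [->|D0] := eqVneq D finset.set0.
  by under eq_fun do rewrite inj_sum0; rewrite T0; exact: cvg_cst.
pose g N := fine (inj_sum N D).
have gE N : inj_sum N D = (g N)%:E by rewrite fineK ?inj_sum_fin.
have g_cvg : cvg (g N @[N --> \oo]).
  apply: nondecreasing_is_cvgn.
    by move=> M N MN; rewrite -lee_fin -!gE inj_sum_nondecreasing.
  by exists (T D) => _ [N _ <-]; rewrite -lee_fin -gE inj_sum_le.
set l := lim (g N @[N --> \oo]) in g_cvg.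
have {}g_cvg : g N @[N --> \oo] --> l by [].
pose y := (T D - c 0 (msize D) * T D)%R.
have y_cvg : (\sum_(h in D) c (n_ h) (msize (D :\ h)) * fine (inj_sum N (D :\ h)))%R
    @[N --> \oo] --> y.
  have -> : y = (\sum_(h in D) c (n_ h) (msize (D :\ h)) * T (D :\ h))%R.
    by rewrite /y [X in (X - _)%R]T_rec addrAC subrr add0r.
  apply: cvg_sumr => h hD; apply: cvgMl_tmp; apply: fine_cvg; apply: IHm.
  by apply: leq_trans Dm; rewrite [in leqRHS](cardsD1 h) hD.
have msize_gt0 : (0 < msize D)%N.
  by have [h hD] := set0Pn _ D0; rewrite /msize (bigD1 h)//= ltn_addr.
have gS : (fun N => g N.+1) = (fun N => c 0 (msize D) * g N +
    \sum_(h in D) c (n_ h) (msize (D :\ h)) * fine (inj_sum N (D :\ h)))%R.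
  apply/funext => N; apply: EFin_inj; rewrite -gE inj_sumS gE EFinD EFinM; congr (_ + _).
  rewrite -sumEFin; apply: eq_bigr => h _.
  by rewrite EFinM fineK// inj_sum_fin.
have lT : l = (c 0 (msize D) * l + y)%R.
  apply: (@cvg_unique _ _ (g N.+1 @[N --> \oo])) => //.
    by have := g_cvg; rewrite -(cvg_shiftS g).
  by rewrite gS; apply: cvgD => //; exact: cvgMl_tmp.
have -> : T D = l.
  have c1 : (1 - c 0 (msize D) != 0)%R by rewrite subr_eq0 gt_eqF// c0_lt1.
  by apply: (mulfI c1); move: lT; rewrite /y => lT; lra.
under eq_fun do rewrite gE; apply: cvg_EFin => //; exact: nearW.
Qed.

(** Every finite family of injections is bounded, hence the sum over all of
    them is the limit of the truncated sums. *)
Lemma esum_injective (gam : {ffun 'I_r -> nat} -> \bar R) :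
  (forall N f, injective f -> (forall h, (f h < N)%N) ->
     gam f = (stick_weight N [set: 'I_r] f)%:E) ->
  \esum_(f in [set f : {ffun 'I_r -> nat} | injective f]%classic) gam f = (T [set: 'I_r])%:E.
Proof.
move=> gamE; have inj_subset N f : injections N [set: 'I_r] f <->
    injective f /\ forall h, (f h < N)%N.
  split=> [[finj _ fN]|[finj fN]]; last by split=> // [h h' _ _ /finj|h]; rewrite ?inE.
  by split=> [h h' /finj|h]; [apply; rewrite inE|apply: fN; rewrite inE].
have bounded f : exists N, forall h : 'I_r, (f h < N)%N.
  by exists (\max_h f h).+1 => h; rewrite ltnS leq_bigmax.
have gam0 f : injective f -> 0 <= gam f.
  move=> finj; have [N fN] := bounded f.
  by rewrite (gamE N)// lee_fin stick_weight_ge0.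
apply/eqP; rewrite eq_le; apply/andP; split; last first.
  have cT : inj_sum N [set: 'I_r] @[N --> \oo] --> (T [set: 'I_r])%:E := @cvg_inj_sum _.
  rewrite -(cvg_lim _ cT)//; apply: lime_le; first by apply/cvg_ex; eexists; exact: cT.
  near=> N; rewrite /inj_sum esum_mkcond [leRHS]esum_mkcond; apply: le_esum => f _.
  case: ifPn => [/set_mem/inj_subset[finj fN]|_]; first by rewrite mem_set// (gamE N).
  by case: ifP => // /set_mem/gam0.
apply: ge_ereal_sup => _ [X [finX Xinj] <-].
have [N XN] : exists N, forall f, X f -> forall h, (f h < N)%N.
  have /choice[B hB] := bounded.
  exists (\max_(f <- fset_set X) B f) => f Xf h; rewrite (leq_trans (hB f h))//.
  by apply: leq_bigmax_seq => //; rewrite in_fset_set// mem_set.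
apply: le_trans (inj_sum_le N _); apply: esum_ge; exists X.
  by split=> // f Xf; apply/inj_subset; split; [exact: Xinj|exact: XN].
apply: lee_fsum => // f Xf.
by rewrite -gamE//; [exact: Xinj|exact: XN].
Unshelve. all: by end_near. Qed.

End FirstStick.

(** * Correlation functions of the stick-breaking sequence *)
Section GEM.
Variables (R : realType) (theta : R).
Hypothesis theta_gt0 : 0 < theta.

Local Notation c := (stick_moment theta).

Let shift_gt0 (k : nat) : 0 < theta + k%:R.
Proof. by rewrite ltr_pwDl// ler0n. Qed.

Lemma stick_moment_ge0 a b : 0 <= c a b.
Proof.
rewrite /stick_moment /beta_int mulr_ge0 ?divr_ge0 ?ler0n ?(ltW theta_gt0)//.
by rewrite ltW// prod_shift_gt0.
Qed.

Lemma stick_moment0 b : c 0 b = theta / (theta + b%:R).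
Proof. by rewrite /stick_moment /beta_int fact0 big_ord1 addr0 div1r. Qed.

Lemma stick_moment00 : c 0 0 = 1.
Proof. by rewrite stick_moment0 addr0 divff ?gt_eqF. Qed.

Lemma stick_moment0_lt1 b : (0 < b)%N -> c 0 b < 1.
Proof. by move=> b0; rewrite stick_moment0 ltr_pdivrMr// mul1r ltrDl ltr0n. Qed.

Lemma risingD m k :
  rising theta (m + k) = rising theta m * \prod_(i < k) (theta + m%:R + i%:R).
Proof.
rewrite /rising big_split_ord/=; congr (_ * _).
by apply: eq_bigr => i _; rewrite natrD addrA.
Qed.

Variables (r : nat) (n_ : 'I_r -> nat).
Hypothesis n_gt0 : forall h, (0 < n_ h)%N.
Implicit Types D : {set 'I_r}.

Local Notation msize := (msize n_).

(** The probability that a sample from the one-colour Ewens partition consists of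
    given blocks of sizes [n_ h]. *)
Definition block_moment D : R :=
  theta ^+ #|D| * \prod_(h in D) ((n_ h).-1`!)%:R / rising theta (msize D).

Lemma block_moment_ge0 D : 0 <= block_moment D.
Proof.
rewrite /block_moment divr_ge0 ?ltW ?(rising_gt0 theta_gt0)//.
by rewrite pmulr_rgt0 ?exprn_gt0// prodr_gt0// => h _; rewrite ltr0n fact_gt0.
Qed.

Lemma block_moment0 : block_moment finset.set0 = 1.
Proof.
by rewrite /block_moment /msize !big_set0 cards0 /rising big_ord0 mulr1 divr1.
Qed.

(** Given the blocks in [D], the block [h] owns the first stick with probability
    [n_h / (theta + msize D)]. *)
Let block_moment_remove D h : h \in D ->
  c (n_ h) (msize (D :\ h)) * block_moment (D :\ h) =
  (n_ h)%:R / (theta + (msize D)%:R) * block_moment D.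
Proof.
move=> hD; have mD : msize D = (msize (D :\ h) + n_ h)%N.
  by rewrite /msize (big_setD1 h)//= addnC.
have r1 : rising theta (msize D) * (theta + (msize D)%:R) =
    rising theta (msize (D :\ h)) *
    \prod_(i < (n_ h).+1) (theta + (msize (D :\ h))%:R + i%:R).
  by rewrite -risingS -risingD addnS -mD.
rewrite /stick_moment /beta_int /block_moment (cardsD1 h D) hD add1n exprS.
rewrite (big_setD1 h hD)/=.
have -> : ((n_ h)`!)%:R = (n_ h)%:R * ((n_ h).-1`!)%:R :> R.
  by rewrite -natrM -{1 2}(prednK (n_gt0 h)) -factS prednK.
move: r1; set rD := rising _ (msize D); set rh := rising _ _; set p := \prod_(i < _) _.
set q := \prod_(i in D :\ h) _; set tD := theta + _.
move=> r1; have rp : rh^-1 * p^-1 = rD^-1 * tD^-1 by rewrite -!invfM r1.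
move: (theta ^+ _) ((n_ h)%:R) (((n_ h).-1`!)%:R) q => t n f q.
transitivity (theta * n * f * t * q * (rh^-1 * p^-1)); first by lra.
by rewrite rp; lra.
Qed.

(** With [n = msize D], the probabilities [theta / (theta + n)], of a first stick
    without a block, and [n_h / (theta + n)] sum to [1]. *)
Lemma block_moment_rec D : block_moment D = c 0 (msize D) * block_moment D +
  \sum_(h in D) c (n_ h) (msize (D :\ h)) * block_moment (D :\ h).
Proof.
rewrite (eq_bigr _ (fun h => @block_moment_remove D h)) stick_moment0.
rewrite -mulr_suml -mulrDl -mulr_suml -natr_sum -mulrDl.
rewrite divff ?mul1r// gt_eqF//.
Qed.

(** Extending the product to a range independent of [k] lets the factors of several
    sticks be regrouped by stick variable. *)
Lemma norm_stick_breaking (v : nat -> R) k N : (k < N)%N ->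
  `|stick_breaking v k| =
  \prod_(i < N) (`|v i| ^+ (k == i) * `|1 - v i| ^+ (i < k)%N).
Proof.
move=> kN; rewrite big_split/= normrM normr_prod; congr (_ * _).
  rewrite (bigD1 (Ordinal kN))//= eqxx expr1 big1 ?mulr1// => i ik.
  by case: eqP => // e; move: ik; rewrite -val_eqE/= e eqxx.
rewrite (big_ord_widen N (fun i => `|1 - v i|) (ltnW kN)) big_mkcond/=.
by apply: eq_bigr => i _; case: (i < k)%N.
Qed.

Context {d} {Omega : measurableType d}.
Variables (P : probability Omega R) (V : nat -> {RV P >-> measurableTypeR R}).
Hypothesis V_law : forall i, has_law P (V i) (beta_law 1 theta).
Hypothesis V_indep : mutually_independent P (fun i w => V i w).
Local Notation W w := (stick_breaking (fun i => V i w)).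

Lemma expectation_stick_power N (f : {ffun 'I_r -> nat}) :
  (forall h, (f h < N)%N) ->
  (\int[P]_w (\prod_(h < r) `|W w (f h)| ^+ n_ h)%:E =
   (stick_weight n_ c N [set: 'I_r] f)%:E)%E.
Proof.
move=> fN; pose a := part_of n_ [set: 'I_r] f; pose b := part_above n_ [set: 'I_r] f.
pose g i (x : R) : \bar R := (`|x| ^+ a i * `|1 - x| ^+ b i)%:E.
have WE w : (\prod_(h < r) `|W w (f h)| ^+ n_ h)%:E = (\prod_(i < N) g i (V i w))%E.
  rewrite /g prodEFin; congr EFin.
  under [LHS]eq_bigr => h _ do rewrite (norm_stick_breaking _ (fN h)) -prodrXl.
  rewrite exchange_big/=; apply: eq_bigr => i _.
  under [LHS]eq_bigr => h _ do rewrite exprMn -!exprM.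
  rewrite big_split/= !prodrXr /a /b /part_of /part_above; congr (_ ^+ _ * _ ^+ _).
    rewrite [RHS]big_mkcond/=; apply: eq_bigr => h _; rewrite inE/=.
    by case: eqP; rewrite ?mul1n ?mul0n.
  rewrite [RHS]big_mkcond/=; apply: eq_bigr => h _; rewrite inE/=.
  by case: ltnP; rewrite ?mul1n ?mul0n.
under eq_integral do rewrite WE.
rewrite (@expectation_prod_independent _ _ _ P _ (measurableTypeR R) (fun i w => V i w) g N)//.
- rewrite /stick_weight -prodEFin; apply: eq_bigr => i _.
  rewrite (@expectation_stick _ _ _ P theta theta_gt0 (V i))//.
  exact: (measurable_funPT (V i)).
- move=> i; apply/measurable_EFinP; apply: measurable_funM.
    by apply: measurable_funX; apply: (measurableT_comp (@normr_measurable R setT)).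
  apply: measurable_funX; apply: (measurableT_comp (@normr_measurable R setT)).
  exact: measurable_funB.
- by move=> i x; rewrite lee_fin mulr_ge0 ?exprn_ge0.
Qed.

Lemma measurable_stick_breaking k :
  measurable_fun setT (fun w => W w k : R).
Proof.
rewrite /stick_breaking; apply: measurable_funM; first exact: (measurable_funPT (V k)).
apply: measurable_prod => i _; apply: measurable_funB => //.
exact: (measurable_funPT (V i)).
Qed.

Lemma expectation_esum_stick :
  (\int[P]_w (\esum_(f in [set f : {ffun 'I_r -> nat} | injective f])
     (\prod_(h < r) `|W w (f h)| ^+ n_ h)%:E) = (block_moment [set: 'I_r])%:E)%E.
Proof.
rewrite integral_esum; last 2 first.
- by move=> f w; rewrite lee_fin prodr_ge0.
- move=> f; apply/measurable_EFinP; apply: measurable_prod => h _.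
  apply: measurable_funX; apply: (measurableT_comp (@normr_measurable R setT)).
  exact: measurable_stick_breaking.
apply: (esum_injective (n_ := n_) (c := c)) => //.
- exact: stick_moment_ge0.
- exact: stick_moment00.
- exact: stick_moment0_lt1.
- exact: block_moment_ge0.
- exact: block_moment0.
- exact: block_moment_rec.
- by move=> N f _ fN; exact: expectation_stick_power.
Qed.

End GEM.

(** * Absence of ties in recursions with independent innovations *)
Section IndependentRecursion.
Local Open Scope ereal_scope.
Context {R : realType}.

Lemma measure_rectangle_unique d1 d2 (T1 : measurableType d1)
    (T2 : measurableType d2) (m1 m2 : {measure set (T1 * T2) -> \bar R}) :
  m1 setT < +oo ->
  (forall A B, measurable A -> measurable B -> m1 (A `*` B) = m2 (A `*` B)) ->
  forall X, measurable X -> m1 X = m2 X.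
Proof.
move=> m1T m12 X mX.
pose C : set (set (T1 * T2)) :=
  [set A `*` B | A in measurable & B in measurable].
have CI : setI_closed C.
  move=> _ _ [A1 mA1 [B1 mB1 <-]] [A2 mA2 [B2 mB2 <-]].
  rewrite -setXI; exists (A1 `&` A2); first exact: measurableI.
  by exists (B1 `&` B2) => //; exact: measurableI.
apply: (measure_unique C (fun=> setT)) => //.
- by rewrite measurable_prod_measurableType.
- by move=> _; exists setT => //; exists setT => //; rewrite setXTT.
- by rewrite bigcup_const.
- by move=> _ [A mA [B mB <-]]; exact: m12.
Qed.

Context {d} {Omega : measurableType d}.
Variable P : probability Omega R.

(** The joint law is the product of the laws, and the sections of the diagonal are
    points. *)
Lemma independent_neq (X : Omega -> measurableTypeR R)
    (Y : {RV P >-> measurableTypeR R}) : measurable_fun setT X ->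
  independent2 P X Y -> (forall y, P (Y @^-1` [set y]) = 0) ->
  P [set w | X w = Y w] = 0.
Proof.
move=> mX XY Y0; pose XYp w := (X w, Y w).
have mXY : measurable_fun setT XYp by exact/measurable_fun_pairP.
pose diag : set (measurableTypeR R * measurableTypeR R) := [set p | p.1 = p.2].
have mdiag : measurable diag.
  have -> : diag = (fun p : measurableTypeR R * measurableTypeR R => p.1 - p.2)%R @^-1` [set 0%R].
    by apply/seteqP; split => p /=; [move->; rewrite subrr|move/subr0_eq].
  by rewrite -[_ @^-1` _]setTI; apply: measurable_funB.
pose mixin := isMeasurableFun.Build _ _ _ _ X mX.
pose X' : {RV P >-> measurableTypeR R} := HB.pack X mixin.
have h := @product_measure_unique _ _ _ _ _ (distribution P X') (distribution P Y)
  (pushforward P XYp).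
have {}h := h mXY _ diag mdiag.
transitivity (pushforward P XYp diag) => //.
rewrite -h; last by move=> A B mA mB; exact: XY.
rewrite /product_measure1/= integral0_eq// => x _.
rewrite (_ : xsection diag x = [set x]); first exact: Y0.
by apply/seteqP; split => y; rewrite /xsection/= inE.
Qed.

Variable U : nat -> {RV P >-> measurableTypeR R}.
Hypothesis U_indep : mutually_independent P (fun i w => U i w).

Let event (B : nat -> set R) n m : set Omega :=
  [set w | forall i, (n <= i < m)%N -> B i (U i w)].

Let measurable_event B n m : (forall i, measurable (B i)) ->
  measurable (event B n m).
Proof.
move=> mB; rewrite (_ : event B n m =
    \bigcap_(i in [set i | (n <= i < m)%N]) (U i @^-1` B i)); last by apply/seteqP; split.
apply: bigcap_measurableType => i _; rewrite -[_ @^-1` _]setTI.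
by apply: (measurable_funPT (U i)) => //; exact: mB.
Qed.

Let P_event B m : (forall i, measurable (B i)) ->
  P (event B 0 m) = \prod_(0 <= i < m) P (U i @^-1` B i).
Proof.
move=> mB; have := @U_indep [fset i | i in iota 0 m]%fset B (fun i _ => mB i).
rewrite (_ : \bigcap_(i in _) _ = event B 0 m); last first.
  by apply/seteqP; split=> w /= h i; have := h i;
      rewrite /= !inE/= mem_iota add0n => {}h iN; exact: h.
move=> ->; rewrite /index_iota subn0 big_imfset//=; apply: perm_big.
by apply: uniq_perm; rewrite ?undup_uniq ?iota_uniq// => i; rewrite ?mem_undup.
Qed.

Variables (G : nat -> R -> R -> R) (Z : nat -> Omega -> R).
Hypothesis mG : forall n, measurable_fun setT (fun p : R * R => G n p.1 p.2).
Hypothesis Z0 : exists z, forall w, Z 0%N w = z.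
Hypothesis ZS : forall n w, Z n.+1 w = G n (Z n w) (U n w).

Let mZ n : measurable_fun setT (Z n).
Proof.
elim: n => [|n IHn].
  have [z Zz] := Z0; rewrite (_ : Z 0%N = cst z); first exact: measurable_cst.
  exact/funext.
rewrite (_ : Z n.+1 = (fun p : R * R => G n p.1 p.2) \o (fun w => (Z n w, U n w))).
  apply: measurableT_comp => //; apply/measurable_fun_pairP; split => //.
  exact: (measurable_funPT (U n)).
by apply/funext => w; rewrite ZS.
Qed.

(** By induction on [n], the state at time [n] is independent of the innovations from
    time [n] on. *)
Let indep_future n D B m : measurable D -> (forall i, measurable (B i)) ->
  P (Z n @^-1` D `&` event B n m) =
  P (Z n @^-1` D) * \prod_(n <= i < m) P (U i @^-1` B i).
Proof.
elim: n D B m => [|n IHn] D B m mD mB.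
  have [z Zz] := Z0; rewrite -P_event//; have [Dz|Dz] := pselect (D z).
    have -> : Z 0%N @^-1` D = setT by apply/seteqP; split => w //= _; rewrite Zz.
    by rewrite setTI probability_setT mul1e.
  have -> : Z 0%N @^-1` D = set0 by apply/seteqP; split => w //=; rewrite Zz.
  by rewrite set0I measure0 mul0e.
have [mn|nm] := leqP m n.+1.
  rewrite big_geq// mule1; congr (P _); apply/seteqP; split => [w []//|w Dw].
  by split=> // i /andP[/leq_ltn_trans h /h]; rewrite ltnNge mn.
pose ZU w : R * R := (Z n w, U n w).
have mZU : measurable_fun setT (fun w => (Z n w, U n w)).
  by apply/measurable_fun_pairP; split; [exact: mZ|exact: (measurable_funPT (U n))].
have mE := @measurable_event B n.+1 m mB.
pose k := \prod_(n.+1 <= i < m) P (U i @^-1` B i).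
have kfin : k \is a fin_num.
  by apply: prode_fin_num => i _; apply: fin_num_measure; rewrite -[_ @^-1` _]setTI;
    apply: (measurable_funPT (U i)) => //; exact: mB.
have k0 : (0 <= fine k)%R by rewrite fine_ge0// prode_ge0.
(* On an event of the future, the law of the pair [(Z n, U n)] is multiplied by a
   constant; it suffices to see this on rectangles, where the induction applies. *)
have eqM := @measure_rectangle_unique _ _ _ _ (pushforward (mrestr P mE) ZU)
  (mscale (NngNum k0) (pushforward P ZU)).
have {}eqM X : measurable X -> P (ZU @^-1` X `&` event B n.+1 m) = k * P (ZU @^-1` X).
  move=> mX; rewrite -[X in _ = X * _](fineK kfin); apply: (eqM mZU mZU) => //.
    rewrite /= /pushforward /mrestr preimage_setT setTI.
    by rewrite (le_lt_trans (probability_le1 _ _))// ltry.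
  move=> A C mA mC; rewrite /= /mscale/= fineK// /pushforward /mrestr.
  pose B' i := if i == n then C else B i.
  have mB' i : measurable (B' i) by rewrite /B'; case: ifP.
  have -> : ZU @^-1` (A `*` C) `&` event B n.+1 m = Z n @^-1` A `&` event B' n m.
    apply/seteqP; split=> w.
      move=> [[/= Aw Cw] Ew]; split=> // i; rewrite /B'; case: eqP => [->//|/eqP ni].
      by move=> /andP[ni' im]; apply: Ew; rewrite im ltn_neqAle eq_sym ni ni'.
    move=> [/= Aw Ew]; split; first split => //=.
      by have := Ew n; rewrite /B' eqxx leqnn (ltnW nm); apply.
    move=> i /andP[ni im]; have := Ew i; rewrite /B' gtn_eqF// (ltnW ni) im; exact.
  have -> : ZU @^-1` (A `*` C) = Z n @^-1` A `&` event B' n n.+1.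
    apply/seteqP; split=> w [/= Aw].
      move=> Cw; split=> // i /andP[ni im].
      have -> : i = n by apply/eqP; rewrite eqn_leq ni -ltnS im.
      by rewrite /B' eqxx.
    by move=> Ew; split=> //=; have := Ew n; rewrite /B' eqxx leqnn ltnSn; apply.
  rewrite !IHn// big_nat1 big_ltn ?(ltnW nm)//.
  rewrite (_ : \prod_(n.+1 <= i < m) P (U i @^-1` B' i) = k); last first.
    rewrite /k; apply: eq_big_nat => i /andP[ni _].
    by rewrite /B' gtn_eqF.
  by rewrite muleA muleC.
have mDG : measurable [set p : R * R | D (G n p.1 p.2)].
  by rewrite -[mkset _]setTI; exact: mG.
rewrite muleC -/k.
have -> : Z n.+1 @^-1` D = ZU @^-1` [set p : R * R | D (G n p.1 p.2)].
  by apply/seteqP; split => w /=; rewrite ZS.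
exact: eqM.
Qed.

Lemma independent_recursion n : independent2 P (Z n : Omega -> measurableTypeR R) (U n).
Proof.
move=> D B mD mB; have := @indep_future n D (fun=> B) n.+1 mD (fun=> mB).
rewrite big_nat1 => <-; congr (P _); apply/seteqP; split=> w [/= Dw Bw]; split=> //.
  move=> i /andP[ni im].
  by have -> : i = n by apply/eqP; rewrite eqn_leq ni -ltnS im.
by apply: Bw; rewrite leqnn ltnSn.
Qed.

Lemma recursion_neq_innovation n : (forall y, P (U n @^-1` [set y]) = 0) ->
  P [set w | Z n w = U n w] = 0.
Proof.
move=> Un0; apply: (@independent_neq (Z n) (U n)) Un0; first exact: mZ.
exact: independent_recursion.
Qed.

End IndependentRecursion.

(** * Almost sure properties of the stick-breaking sequence *)
Lemma mutually_independent_shift (R : realType) d d1 (Omega : measurableType d)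
    (T1 : measurableType d1) (P : probability Omega R) (X : nat -> Omega -> T1) k :
  mutually_independent P X -> mutually_independent P (fun i => X (k + i)%N).
Proof.
move=> indX J B mB; pose B' i := B (i - k)%N.
have kinj : injective (addn k) by exact: addnI.
have := indX [fset (k + i)%N | i in J]%fset B'.
rewrite big_imfset//=; last by move=> i j _ _; exact: kinj.
rewrite (_ : \bigcap_(i in [set` _]) _ = \bigcap_(i in [set` J]) X (k + i)%N @^-1` B i).
  rewrite (eq_bigr (fun i => P (X (k + i)%N @^-1` B i))) => [|i _]; first apply.
    by move=> _ /imfsetP[i iJ ->]; rewrite /B' addKn; exact: mB.
  by rewrite /B' addKn.
apply/seteqP; split=> w /= h i iJ; last first.
  by move: iJ => /imfsetP[j /= jJ ->]; rewrite /B' addKn; exact: h.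
have := h (k + i)%N; rewrite /B' addKn; apply.
by apply/imfsetP; exists i.
Qed.

Section StickBreakingAlmostSurely.
Context {R : realType} {theta : R} (theta_gt0 : 0 < theta).
Context {d} {Omega : measurableType d}.
Variables (P : probability Omega R) (V : nat -> {RV P >-> measurableTypeR R}).
Hypothesis V_law : forall i, has_law P (V i) (beta_law 1 theta).
Hypothesis V_indep : mutually_independent P (fun i w => V i w).
Local Notation W w := (stick_breaking (fun i => V i w)).

Lemma beta_law_set1 (x : R) : beta_law 1 theta [set x] = 0%E.
Proof. by rewrite /beta_law (integral_Sset1 x)// => y []. Qed.

Let ae_compl (Q : Omega -> Prop) (A : set Omega) : measurable A -> P A = 0%E ->
  (forall w, ~ A w -> Q w) -> {ae P, forall w, Q w}.
Proof.
move=> mA PA AQ; exists A; split => // w /= Qw.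
by apply: contrapT => /AQ.
Qed.

Let measurable_V i B : measurable B -> measurable (V i @^-1` B).
Proof. by move=> mB; rewrite -[_ @^-1` _]setTI; apply: (measurable_funPT (V i)). Qed.

Lemma ae_stick_itv : {ae P, forall w, forall i, 0 <= V i w < 1}.
Proof.
apply: ae_foralln => i; pose B : set R := ~` `[0, 1]%classic `|` [set 1].
have mB : measurable B by apply: measurableU => //; exact: measurableC.
apply: (ae_compl (measurable_V i mB)).
  have := V_law i mB; rewrite /beta_law => ->; apply: (integral_Sset1 1) => x [].
  by case.
move=> w /not_orP[/contrapT]; rewrite /= in_itv/= => /andP[-> V1] /eqP Vn1.
by rewrite lt_neqAle Vn1.
Qed.

(** A tie [W_i = W_(i+n+1)] forces [V_(i+n+1)] to equal the quotient of [V_i] by the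
    product of the [1 - V_j] for [i <= j <= i + n]. This quotient is a recursion in
    the variables from [V_i] to [V_(i+n)], so that the absence of atoms excludes the
    tie. *)
Let tie i n : {ae P, forall w, (forall j, V j w < 1) -> W w i <> W w (i + n.+1)%N}.
Proof.
pose U k := V (i + k)%N.
(* The inverse is written as a power, since powers are measurable. *)
pose G k (z u : R) := (if k is 0 then u else z) * (1 - u) `^ (- 1).
pose Z := fix Z k w : R := if k is k'.+1 then G k' (Z k' w) (U k' w) else 0.
have mG k : measurable_fun setT (fun p : R * R => G k p.1 p.2).
  apply: measurable_funM; first by case: k => [|k]; [exact: measurable_snd|exact: measurable_fst].
  by apply: (measurableT_comp (measurable_powR _)); exact: measurable_funB.
have PZ : P [set w | Z n.+1 w = U n.+1 w] = 0%E.
  apply: (@recursion_neq_innovation _ _ _ P U _ G Z mG) => //.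
  - exact: (@mutually_independent_shift _ _ _ _ _ P (fun i w => V i w) i V_indep).
  - by exists 0.
  - move=> y; rewrite /U; have := V_law (i + n.+1)%N (measurable_set1 y).
    by rewrite beta_law_set1.
have mZ k : measurable_fun setT (Z k).
  elim: k => [|k IHk]; first exact: measurable_cst.
  have mpair : measurable_fun setT (fun w => (Z k w, U k w)).
    by apply/measurable_fun_pairP; split; [exact: IHk|exact: (measurable_funPT (U k))].
  exact: (measurableT_comp (mG k) mpair).
have mtie : measurable [set w | Z n.+1 w = U n.+1 w].
  rewrite (_ : mkset _ = (fun w => Z n.+1 w - U n.+1 w) @^-1` [set 0]); last first.
    by apply/seteqP; split => w /=; [move->; rewrite subrr|move/subr0_eq].
  rewrite -[_ @^-1` _]setTI; apply: measurable_funB => //.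
  exact: (measurable_funPT (U n.+1)).
have ZS k w : Z k.+1 w = G k (Z k w) (U k w) by [].
apply: (ae_compl mtie PZ) => w ZU V1 WW; apply: ZU.
change (Z n.+1 w = U n.+1 w); clearbody Z.
have V0 j : 1 - V j w != 0 by rewrite subr_eq0 gt_eqF.
have ZE k : Z k.+1 w * \prod_(m < k.+1) (1 - U m w) = U 0 w.
  have G_inv (z u : R) : 0 < 1 - u -> (z * ((1 - u) `^ (- 1)) * (1 - u))%R = z.
    by move=> u0; rewrite powR_inv1 ?ltW// divfK// gt_eqF.
  have V1' j : 0 < 1 - V j w by rewrite subr_gt0.
  elim: k => [|k IHk]; first by rewrite big_ord1 ZS /G G_inv//; exact: V1'.
  rewrite big_ord_recr/= ZS /G [\prod_(_ < _) _ * _]mulrC mulrA G_inv//.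
  exact: V1'.
have p0 (f : nat -> nat) m : \prod_(j < m) (1 - V (f j) w) != 0.
  by apply/prodf_neq0 => j _.
move: WW; rewrite /stick_breaking.
have -> : \prod_(j < i + n.+1) (1 - V j w) =
    \prod_(j < i) (1 - V j w) * \prod_(m < n.+1) (1 - U m w).
  by rewrite big_split_ord.
rewrite mulrCA => WW.
have {}WW : V i w = V (i + n.+1)%N w * \prod_(m < n.+1) (1 - U m w).
  by apply: (mulfI (p0 id i)); rewrite -WW mulrC.
apply: (mulIf (p0 (addn i) n.+1)); transitivity (U 0 w); first exact: ZE.
by rewrite -[RHS]WW /U addn0.
Qed.

Lemma ae_stick_inj : {ae P, forall w, injective (W w)}.
Proof.
have : {ae P, forall w, forall i n, (forall j, V j w < 1) -> W w i <> W w (i + n.+1)%N}.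
  by apply: ae_foralln => i; apply: ae_foralln => n; exact: tie.
apply: filterS2 ae_stick_itv => w V01 h i j.
have {}h a b : W w a = W w b -> (a < b)%N -> False.
  move=> e ab; apply: (h a (b - a.+1)%N).
    by move=> k; have /andP[] := V01 k.
  by rewrite addnS -addSn subnKC.
by move=> e; have [/(h _ _ e)//|/(h _ _ (esym e))//|] := ltngtP i j.
Qed.

Lemma stick_breaking_ge0 (v : nat -> R) k :
  (forall i, 0 <= v i < 1) -> 0 <= stick_breaking v k.
Proof.
move=> v01; apply: mulr_ge0; first by have /andP[] := v01 k.
by apply: prodr_ge0 => i _; have /andP[_ /ltW] := v01 i; rewrite subr_ge0.
Qed.

Lemma sum_stick_breaking (v : nat -> R) N :
  \sum_(i < N) stick_breaking v i = 1 - \prod_(i < N) (1 - v i).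
Proof.
elim: N => [|N IHN]; first by rewrite !big_ord0 subrr.
by rewrite big_ord_recr/= IHN big_ord_recr/= /stick_breaking; lra.
Qed.

Local Open Scope ereal_scope.

Lemma esum_stick_breaking_le1 (v : nat -> R) :
  (forall i, 0 <= v i < 1)%R -> \esum_(i in setT) (`|stick_breaking v i|)%:E <= 1.
Proof.
move=> v01; rewrite -nneseries_esumT//; apply: lime_le.
  by apply: is_cvg_nneseries.
near=> N; rewrite big_mkord sumEFin lee_fin.
under eq_bigr do rewrite ger0_norm ?stick_breaking_ge0//.
rewrite sum_stick_breaking lerBlDr lerDl prodr_ge0// => i _.
by have /andP[_ /ltW] := v01 i; rewrite subr_ge0.
Unshelve. all: by end_near. Qed.

(** The total length is at most [1], and its expectation is [1] by the formula for
    the correlation functions with a single block of size [1]. *)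
Lemma ae_stick_sum1 : {ae P, forall w, \esum_(i in setT) (`|W w i|)%:E = 1}.
Proof.
pose Q w := \esum_(i in setT) (`|W w i|)%:E.
have mQ : measurable_fun setT Q.
  apply: measurable_esum => [i w|i]; first by rewrite lee_fin.
  apply/measurable_EFinP; apply: (measurableT_comp (@normr_measurable R setT)).
  exact: measurable_stick_breaking.
have Q0 w : 0 <= Q w by apply: esum_ge0 => i _; rewrite lee_fin.
have IQ : \int[P]_w Q w = 1.
  (* A sum over injections of a singleton is a plain sum. *)
  pose n_ (h : 'I_1) := 1%N.
  have := @expectation_esum_stick _ _ theta_gt0 1 n_ (fun=> erefl) _ _ _ _ V_law V_indep.
  rewrite /block_moment /msize !(big_pred1 ord0); last 2 first.
  - by move=> h; rewrite finset.in_setT/= (ord1 h).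
  - by move=> h; rewrite finset.in_setT/= (ord1 h).
  rewrite cardsT card_ord expr1 /rising big_ord1 addr0 fact0 mulr1 divff ?gt_eqF//.
  move=> <-; apply: eq_integral => w _.
  rewrite /Q (reindex_esum setT setT (fun f : {ffun 'I_1 -> nat} => f ord0))//.
    rewrite (_ : setT = [set f : {ffun 'I_1 -> nat} | injective f])//.
      by apply: eq_esum => f _; rewrite big_ord1.
    by apply/seteqP; split=> // f _ h h' _; rewrite !ord1.
  split=> //.
  - by move=> f g _ _ fg; apply/ffunP => h; rewrite ord1.
  - by move=> k _; exists [ffun=> k] => //; rewrite ffunE.
have Q1 : {ae P, forall w, Q w <= 1}.
  by apply: filterS ae_stick_itv => w; exact: esum_stick_breaking_le1.
(* Capping at [1] makes the defect [1 - Q] nonnegative everywhere. *)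
pose Q' w := mine (Q w) 1.
have mQ' : measurable_fun setT Q' by exact: measurable_mine.
have Q'0 w : 0 <= Q' w by rewrite le_min Q0 lee01.
have IQ' : \int[P]_w Q' w = 1.
  rewrite -IQ; apply: ge0_ae_eq_integral => //.
  by apply: filterS Q1 => w Qw _; rewrite /Q' min_l.
have Q'1 w : Q' w <= 1 by rewrite ge_min lexx orbT.
have Q'fin w : Q' w \is a fin_num by rewrite ge0_fin_numE// (le_lt_trans (Q'1 w))// ltry.
have Q''0 w : 0 <= 1 - Q' w by rewrite subre_ge0.
have mQ'' : measurable_fun setT (fun w => 1 - Q' w).
  exact: emeasurable_funB.
have I0 : \int[P]_w (1 - Q' w) = 0.
  have : \int[P]_w ((1 - Q' w) + Q' w) = 1.
    under eq_integral do rewrite subeK//.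
    rewrite integral_cst// mul1e; exact: probability_setT.
  rewrite ge0_integralD//.
  by rewrite IQ' => /(congr1 (fun z => z - 1)); rewrite addeK// subee.
have := (ae_eq_integral_abs P measurableT mQ'').1.
under eq_integral do rewrite gee0_abs//.
move=> /(_ I0); apply: filterS2 Q1 => w Qw /(_ I).
move=> /(congr1 (fun z => z + Q' w)); rewrite /cst subeK// add0e => {1}->.
by rewrite /Q' min_l.
Qed.

End StickBreakingAlmostSurely.

(** * Measurability in the sequence spaces *)
Section BorelMeasurability.
Variable R : realType.

Lemma continuous_borel_measurable (T : ptopologicalType) (f : T -> R) :
  continuous f -> measurable_fun (setT : set (borel T)) (f : borel T -> R).
Proof.
move=> /continuousP cf; apply: (measurability _ (RGenOpens.measurableE R)).
move=> _ [_ [a [b ->] <-]]; rewrite setTI; apply: sub_sigma_algebra.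
exact/cf/interval_open.
Qed.

Lemma measurable_seq_proj (T : ptopologicalType) i :
  measurable_fun setT (fun x : seq_space T => x i : borel T).
Proof.
apply: (@measurability _ _ (seq_space T) (borel T) setT (fun x => x i) (@open T)) => // _ [A oA <-].
rewrite setTI; apply: sub_sigma_algebra.
have cp : continuous ((fun x => x i) : prod_topology (fun _ : nat => T) -> T).
  exact: (@proj_continuous nat (fun _ : nat => T) i).
by move/continuousP: cp; apply.
Qed.

Context {d} {T : measurableType d}.

Lemma measurable_fun_le_set (f g : T -> R) :
  measurable_fun setT f -> measurable_fun setT g -> measurable [set x | f x <= g x].
Proof.
move=> mf mg; rewrite (_ : mkset _ = (fun x => g x - f x) @^-1` `[0, +oo[%classic).
  by rewrite -[_ @^-1` _]setTI; apply: measurable_funB.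
by apply/seteqP; split => x /=; rewrite in_itv/= andbT subr_ge0.
Qed.

Lemma measurable_fun_lt_set (f g : T -> R) :
  measurable_fun setT f -> measurable_fun setT g -> measurable [set x | f x < g x].
Proof.
move=> mf mg; rewrite (_ : mkset _ = ~` [set x | g x <= f x]).
  by apply: measurableC; exact: measurable_fun_le_set.
by apply/seteqP; split => x /=; rewrite real_ltNge ?num_real// => /negP.
Qed.

Lemma measurable_lexi_set (I : Type) (s : seq I) (f g : I -> T -> R) :
  (forall i, measurable_fun setT (f i)) -> (forall i, measurable_fun setT (g i)) ->
  measurable [set x | (([seq f i x | i <- s] : seqlexi R) <= [seq g i x | i <- s])%O].
Proof.
move=> mf mg; elim: s => [|i s IHs].
  by rewrite (_ : mkset _ = setT)//; apply/seteqP; split.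
rewrite (_ : mkset _ = [set x | f i x <= g i x] `&`
    ([set x | f i x < g i x] `|`
     [set x | (([seq f i x | i <- s] : seqlexi R) <= [seq g i x | i <- s])%O])).
  apply: measurableI; first exact: measurable_fun_le_set.
  by apply: measurableU => //; exact: measurable_fun_lt_set.
apply/seteqP; split => x; rewrite /= Order.SeqLexiOrder.lexi_cons.
  move=> /andP[fg /implyP h]; split=> //; have [|/h] := ltP (f i x) (g i x); by [left|right].
move=> [-> /= [fg|->]]; last exact: implybT.
by rewrite leNgt fg.
Qed.

End BorelMeasurability.

Section MassPartitions.
Variable R : realType.

Lemma measurable_seq_coord i : measurable_fun setT (fun l : seq_space R => l i : R).
Proof.
have cid : continuous (idfun : R -> R) by move=> x; exact: cvg_id.
exact: (measurableT_comp (continuous_borel_measurable cid) (@measurable_seq_proj R i)).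
Qed.

(** For these mass partitions the sizes alone decide the shortlex order of the
    coloured sequence. *)
Definition strict_mass_partition : set (seq_space R) :=
  [set l | [/\ forall i, 0 <= l i, forall i, l i.+1 < l i &
            (\esum_(i in setT) (`|l i|)%:E = 1)%E]].

Lemma measurable_strict_mass_partition : measurable strict_mass_partition.
Proof.
rewrite (_ : strict_mass_partition =
    \bigcap_i [set l | cst 0 l <= l i] `&` \bigcap_i [set l | l i.+1 < l i] `&`
    (fun l : seq_space R => \esum_(i in setT) (`|l i|)%:E)%E @^-1` [set 1%E]).
  apply: measurableI; first apply: measurableI.
  - apply: bigcapT_measurable => i; apply: measurable_fun_le_set => //.
    exact: measurable_seq_coord.
  - apply: bigcapT_measurable => i; apply: measurable_fun_lt_set;
      exact: measurable_seq_coord.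
  - rewrite -[_ @^-1` _]setTI; apply: measurable_esum => //.
    move=> i; apply/measurable_EFinP; apply: (measurableT_comp (@normr_measurable R setT)).
    exact: measurable_seq_coord.
apply/seteqP; split=> l /=.
  by move=> [l0 ll l1]; split=> //; split=> i _; [exact: l0|exact: ll].
by move=> [[l0 ll] l1]; split=> // i; [exact: l0|exact: ll].
Qed.

End MassPartitions.

Section MonomMeasurability.
Variables (R : realType) (q : nat).

Lemma measurable_entry j : measurable_fun setT (fun u : borel 'rV[R]_q => u 0 j : R).
Proof.
have c : continuous (fun u : 'rV[R]_q => u 0 j : R) by exact: coord_continuous.
exact: continuous_borel_measurable c.
Qed.

Lemma measurable_monom a : measurable_fun setT (fun u : borel 'rV[R]_q => monom u a).
Proof.
by apply: measurable_prod => j _; apply: measurable_funX; exact: measurable_entry.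
Qed.

Lemma measurable_vabs : measurable_fun setT (fun u : borel 'rV[R]_q => vabs u).
Proof.
apply: measurable_sum => j; apply: (measurableT_comp (@normr_measurable R setT)).
exact: measurable_entry.
Qed.

Lemma measurable_simplex : measurable (@simplex R q : set (borel 'rV[R]_q)).
Proof.
rewrite (_ : @simplex R q = \bigcap_(j in [set: 'I_q])
   ((fun u : borel 'rV[R]_q => u 0 j) @^-1` `[0, 1]%classic) `&`
   (fun u : borel 'rV[R]_q => vabs u) @^-1` [set 1]); last first.
  apply/seteqP; split=> u /=; first by move=> [u01 u1]; split=> // j _; rewrite /= in_itv/=.
  by move=> [u01 u1]; split=> // j; have := u01 j I; rewrite /= in_itv.
apply: measurableI.
  apply: fin_bigcap_measurable => // j _.
  by rewrite -[_ @^-1` _]setTI; apply: measurable_entry.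
by rewrite -[_ @^-1` _]setTI; apply: measurable_vabs.
Qed.

Lemma measurable_nabla : measurable (@nabla R q : set (seq_space 'rV[R]_q)).
Proof.
rewrite (_ : @nabla R q = \bigcap_i \bigcap_(j in [set: 'I_q])
     [set x : seq_space 'rV[R]_q | cst 0 x <= x i 0 j] `&`
   \bigcap_(i in [set i | (1 <= i)%N])
     [set x : seq_space 'rV[R]_q | vsl_le (x i.+1) (x i)] `&`
   (fun x : seq_space 'rV[R]_q => \sum_(0 <= i <oo) (vabs (x i))%:E)%E @^-1` [set 1%E]);
    last first.
  apply/seteqP; split=> x /=; first by move=> [x0 xx x1]; split=> //; split=> [i _ j _|]; [exact: x0|exact: xx].
  by move=> [[x0 xx] x1]; split=> // i j; exact: x0.
have mentry i j : measurable_fun setT (fun x : seq_space 'rV[R]_q => x i 0 j : R).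
  exact: (measurableT_comp (measurable_entry j) (@measurable_seq_proj _ i)).
have mvabs i : measurable_fun setT (fun x : seq_space 'rV[R]_q => vabs (x i) : R).
  exact: (measurableT_comp measurable_vabs (@measurable_seq_proj _ i)).
apply: measurableI; first apply: measurableI.
- apply: bigcapT_measurable => i; apply: fin_bigcap_measurable => // j _.
  exact: measurable_fun_le_set.
- apply: bigcap_measurableType => i _.
  pose F (k : nat) (o : option 'I_q) (x : seq_space 'rV[R]_q) :=
    if o is Some j then x k 0 j else vabs (x k).
  have mF k o : measurable_fun setT (F k o) by case: o => [j|]; [exact: mentry|exact: mvabs].
  rewrite (_ : mkset _ = [set x |
      (([seq F i.+1 o x | o <- None :: [seq Some j | j <- enum 'I_q]] : seqlexi R) <=
       [seq F i o x | o <- None :: [seq Some j | j <- enum 'I_q]])%O]).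
    exact: measurable_lexi_set.
  by apply/funext => x; rewrite /= /vsl_le /vsl_key -!map_comp.
- rewrite -[_ @^-1` _]setTI; apply: ge0_emeasurable_sum => //.
  + by move=> k x _ _; rewrite lee_fin sumr_ge0.
  + by move=> k _; exact/measurable_EFinP.
Qed.

End MonomMeasurability.

(** * The weights of the polychromatic Ewens sampling formula *)
Section Moments.
Variables (R : realType) (q : nat) (nu : probability (borel 'rV[R]_q) R).
Hypothesis nu_simplex : nu (@simplex R q) = 1%E.
Implicit Types (u : 'rV[R]_q) (a b : mindex q).

Lemma monom_msucc u b j : monom u (msucc b j) = monom u b * u 0 j.
Proof.
rewrite /monom (bigD1 j)//= [in RHS](bigD1 j)//= ffunE eqxx addn1 exprSr.
rewrite mulrAC; congr (_ * _ * _); apply: eq_bigr => k /negPf kj.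
by rewrite ffunE kj addn0.
Qed.

Lemma monom_mzero u : monom u (mzero q) = 1.
Proof. by rewrite /monom big1// => j _; rewrite ffunE expr0. Qed.

Lemma monom_ge0 u a : (forall j, 0 <= u 0 j) -> 0 <= monom u a.
Proof. by move=> u0; apply: prodr_ge0 => j _; rewrite exprn_ge0. Qed.

Lemma monom_simplex u a : simplex u -> 0 <= monom u a <= 1.
Proof.
move=> [u01 _]; rewrite monom_ge0 => [|j]; last by have /andP[] := u01 j.
by apply: prodr_ile1 => j _; have /andP[u0 u1] := u01 j; rewrite exprn_ge0//= exprn_ile1.
Qed.

Let mmonom a (D : set (borel 'rV[R]_q)) : measurable D ->
  measurable_fun D (fun u => (monom u a)%:E).
Proof.
by move=> mD; apply: measurable_funTS; apply/measurable_EFinP; exact: measurable_monom.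
Qed.

Lemma moment_integral a :
  ((moment nu a)%:E = \int[nu]_(u in @simplex R q) (monom u a)%:E)%E.
Proof.
rewrite /moment /Rintegral fineK// ge0_fin_numE; last first.
  by apply: integral_ge0 => u /(monom_simplex a) /andP[m0 _]; rewrite lee_fin.
apply: (@le_lt_trans _ _ (\int[nu]_(u in @simplex R q) 1)%E).
  apply: ge0_le_integral => //.
  - exact: measurable_simplex.
  - by move=> u /(monom_simplex a) /andP[m0 _]; rewrite lee_fin.
  - apply: mmonom; exact: measurable_simplex.
  - by move=> u /(monom_simplex a) /andP[_ m1]; rewrite lee_fin.
rewrite integral_cst; last exact: measurable_simplex.
by rewrite mul1e [X in (X < _)%E]nu_simplex ltry.
Qed.

Lemma moment_ge0 a : 0 <= moment nu a.
Proof.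
rewrite -lee_fin moment_integral; apply: integral_ge0 => u.
by move=> /(monom_simplex a) /andP[m0 _]; rewrite lee_fin.
Qed.

Lemma moment0 : moment nu (mzero q) = 1.
Proof.
apply: EFin_inj; rewrite moment_integral.
under eq_integral do rewrite monom_mzero.
rewrite integral_cst; last exact: measurable_simplex.
by rewrite mul1e [LHS]nu_simplex.
Qed.

(** The coordinates of a point of the simplex sum to [1]. *)
Lemma sum_moment_msucc b : \sum_(j < q) moment nu (msucc b j) = moment nu b.
Proof.
apply: EFin_inj; rewrite -sumEFin moment_integral.
under eq_bigr do rewrite moment_integral.
rewrite -ge0_integral_sum//.
- apply: eq_integral => u /set_mem [u01 u1]; rewrite sumEFin; congr EFin.
  under eq_bigr do rewrite monom_msucc; rewrite -mulr_sumr.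
  have -> : \sum_(j < q) u 0 j = vabs u.
    by apply: eq_bigr => j _; rewrite ger0_norm//; have /andP[] := u01 j.
  by rewrite u1 mulr1.
- exact: measurable_simplex.
- by move=> j; apply: mmonom; exact: measurable_simplex.
- by move=> j u /(monom_simplex (msucc b j)) /andP[m0 _]; rewrite lee_fin.
Qed.

(** The coordinates are nonnegative [nu]-almost surely. *)
Lemma integral_norm_monom a : (\int[nu]_u (`|monom u a|)%:E = (moment nu a)%:E)%E.
Proof.
rewrite moment_integral [RHS]integral_mkcond; apply: ge0_ae_eq_integral => //.
- apply/measurable_EFinP; apply: (measurableT_comp (@normr_measurable R setT)).
  exact: measurable_monom.
- apply/(measurable_restrictT _ _).1; first exact: measurable_simplex.
  apply: mmonom; exact: measurable_simplex.
- move=> u _; apply: erestrict_ge0 => v /(monom_simplex a) /andP[m0 _].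
  by rewrite lee_fin.
exists (~` (@simplex R q)); split.
- by apply: measurableC; exact: measurable_simplex.
- by have := probability_setC nu (@measurable_simplex R q); rewrite nu_simplex subee.
move=> u /= h Su; apply: h => _; rewrite patchE mem_set// ger0_norm//.
by have /andP[] := monom_simplex a Su.
Qed.

Variable theta : R.
Hypothesis theta_gt0 : 0 < theta.

Definition ewens_weight a : R :=
  theta / (mabs a)%:R * (((mabs a)`!)%:R / (mfact a)%:R) * moment nu a.

Lemma ewens_weight_ge0 a : 0 <= ewens_weight a.
Proof. by rewrite /ewens_weight !mulr_ge0 ?invr_ge0 ?moment_ge0 ?ler0n// ltW. Qed.

(** The factor [b_j + 1] cancels against the factorial of [b + e_j], after which the
    colour [j] only appears in the moment. *)
Lemma ewens_weight_msucc b j : (b j).+1%:R * ewens_weight (msucc b j) =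
  theta * ((mabs b)`!)%:R / (mfact b)%:R * moment nu (msucc b j).
Proof.
rewrite /ewens_weight mabs_msucc mfact_msucc factS !natrM.
have bj : (b j).+1%:R != 0 :> R by rewrite pnatr_eq0.
have bS : (mabs b).+1%:R != 0 :> R by rewrite pnatr_eq0.
rewrite !invfM; move: (moment _ _) => m0.
move: (mfact b)%:R^-1 ((mabs b)`!)%:R => m f.
transitivity (theta * f * m * m0 * ((b j).+1%:R / (b j).+1%:R) *
  ((mabs b).+1%:R / (mabs b).+1%:R)); last by rewrite !divff// !mulr1.
move: ((b j).+1%:R) ((mabs b).+1%:R) ((b j).+1%:R^-1) ((mabs b).+1%:R^-1).
by move=> *; lra.
Qed.

Lemma sum_ewens_weight_delta : \sum_(j < q) ewens_weight (mdelta j) = theta.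
Proof.
under eq_bigr => j _ do rewrite -msucc0.
transitivity (\sum_(j < q) theta * moment nu (msucc (mzero q) j)).
  apply: eq_bigr => j _; have := ewens_weight_msucc (mzero q) j.
  rewrite ffunE mul1r => ->; rewrite mabs0 fact0 mulr1 /mfact big1 ?divr1//.
  by move=> k _; rewrite ffunE.
by rewrite -mulr_sumr sum_moment_msucc moment0 mulr1.
Qed.

Lemma sum_ewens_weight_msucc b : b != mzero q ->
  \sum_(j < q) (b j).+1%:R * ewens_weight (msucc b j) = (mabs b)%:R * ewens_weight b.
Proof.
move=> b0; under eq_bigr do rewrite ewens_weight_msucc.
rewrite -mulr_sumr sum_moment_msucc /ewens_weight.
have mb : (mabs b)%:R != 0 :> R by rewrite pnatr_eq0 mabs_eq0.
move: (moment _ _) (mfact b)%:R^-1 ((mabs b)`!)%:R => m0 m f.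
transitivity (theta * f * m * m0 * ((mabs b)%:R / (mabs b)%:R)).
  by rewrite divff// mulr1.
by move: ((mabs b)%:R) ((mabs b)%:R^-1) => *; lra.
Qed.

Lemma pESF_partition_structure : partition_structure (pESF theta nu).
Proof.
split.
  move=> n A _; rewrite /pESF mulr_ge0//.
    by rewrite divr_ge0 ?ler0n// ltW// rising_gt0.
  apply: prodr_ge0 => a _; rewrite mulr_ge0 ?invr_ge0 ?ler0n//.
  by rewrite exprn_ge0// ewens_weight_ge0.
split=> [n|[//|n] B _ /=].
  exact: sum_sampling_formula theta_gt0 sum_ewens_weight_delta sum_ewens_weight_msucc n.
exact: sampling_formula_consistent theta_gt0 sum_ewens_weight_delta sum_ewens_weight_msucc n B.
Qed.

End Moments.

(** * The ranked sequence *)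
Section RankedSequence.
Variables (R : realType) (theta : R).
Hypothesis theta_gt0 : 0 < theta.
Local Open Scope ereal_scope.

Definition block_sum r (n_ : 'I_r -> nat) (l : nat -> R) : \bar R :=
  \esum_(f in [set f : {ffun 'I_r -> nat} | injective f])
    (\prod_(h < r) `|l (f h)| ^+ n_ h)%:E.

(** Sums over injective maps do not see the order of the sequence. *)
Lemma block_sum_rearrangement r (n_ : 'I_r -> nat) (w l : nat -> R) :
  decreasing_rearrangement w l -> block_sum n_ l = block_sum n_ w.
Proof.
move=> [_ [s [t st ts] lE]]; rewrite /block_sum.
rewrite [RHS](reindex_esum [set f : {ffun 'I_r -> nat} | injective f] _
  (fun f : {ffun 'I_r -> nat} => [ffun h => s (f h)])).
  apply: eq_esum => f _; congr EFin; apply: eq_bigr => h _.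
  by rewrite ffunE lE.
split.
- by move=> f finj h h'; rewrite !ffunE => /(can_inj st) /finj.
- move=> f g _ _ /ffunP fg; apply/ffunP => h; have := fg h.
  by rewrite !ffunE => /(can_inj st).
- move=> f finj; exists [ffun h => t (f h)].
    by move=> h h'; rewrite !ffunE => /(can_inj ts) /finj.
  by apply/ffunP => h; rewrite !ffunE ts.
Qed.

Lemma measurable_block_sum r (n_ : 'I_r -> nat) :
  measurable_fun setT (fun l : seq_space R => block_sum n_ l).
Proof.
apply: measurable_esum => [f l|f]; first by rewrite lee_fin prodr_ge0.
apply/measurable_EFinP; apply: measurable_prod => h _; apply: measurable_funX.
apply: (measurableT_comp (@normr_measurable R setT)); exact: measurable_seq_coord.
Qed.

Lemma block_sum_ge0 r (n_ : 'I_r -> nat) l : 0 <= block_sum n_ l.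
Proof. by apply: esum_ge0 => f _; rewrite lee_fin prodr_ge0. Qed.

(** A rearrangement of an injective sequence is injective, hence strictly decreasing
    as soon as it is nonincreasing. *)
Lemma rearrangement_strict_mass_partition (w l : nat -> R) :
  (forall i, (0 <= w i)%R) -> injective w ->
  \esum_(i in setT) (`|w i|)%:E = 1 ->
  decreasing_rearrangement w l -> strict_mass_partition l.
Proof.
move=> w0 winj w1 [lmon [s sbij lE]]; split.
- by move=> i; rewrite lE /=.
- move=> i; rewrite lt_neqAle lmon// andbT; apply/eqP; rewrite !lE /= => /winj.
  by move=> /(bij_inj sbij) /eqP; rewrite gtn_eqF.
- rewrite -w1 [RHS](reindex_esum setT _ s); last by rewrite setTT_bijective.
  by apply: eq_esum => i _; rewrite lE.
Qed.

Context {d} {Omega : measurableType d}.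
Variables (P : probability Omega R) (L : {RV P >-> seq_space R}).
Hypothesis L_law : poisson_dirichlet theta (distribution P L).

Lemma expectation_block_sum r (n_ : 'I_r -> nat) : (forall h, (0 < n_ h)%N) ->
  \int[P]_w block_sum n_ (L w) = (block_moment theta n_ [set: 'I_r])%:E.
Proof.
move=> n_gt0; have [d0 [Om0 [P0 [V [L0 [V_law V_indep L0W LL0]]]]]] := L_law.
have mL : measurable_fun setT (L : Omega -> seq_space R) := measurable_funPT L.
have mL0 : measurable_fun setT (L0 : Om0 -> seq_space R) := measurable_funPT L0.
rewrite (@integral_same_law _ _ (seq_space R) _ _ _ _ P P0 L L0)//; last 3 first.
- by move=> B mB; exact: esym (LL0 B mB).
- exact: measurable_block_sum.
- exact: block_sum_ge0.
rewrite -(expectation_esum_stick theta_gt0 n_gt0 V_law V_indep).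
apply: ge0_ae_eq_integral => //.
- exact: (measurableT_comp (@measurable_block_sum r n_) mL0).
- apply: measurable_esum => [f w|f]; first by rewrite lee_fin prodr_ge0.
  apply/measurable_EFinP; apply: measurable_prod => h _; apply: measurable_funX.
  apply: (measurableT_comp (@normr_measurable R setT)).
  exact: measurable_stick_breaking.
- by move=> w _; exact: block_sum_ge0.
- by move=> w _; exact: block_sum_ge0.
by apply: filterS L0W => w Lw _; exact: block_sum_rearrangement.
Qed.

Lemma ae_strict_mass_partition : {ae P, forall w, strict_mass_partition (L w)}.
Proof.
have [d0 [Om0 [P0 [V [L0 [V_law V_indep L0W LL0]]]]]] := L_law.
have mL : measurable_fun setT (L : Omega -> seq_space R) := measurable_funPT L.
have mS := @measurable_strict_mass_partition R.
have : {ae P0, forall w, strict_mass_partition (L0 w)}.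
  have sum1 := ae_stick_sum1 theta_gt0 V_law V_indep.
  have inj := ae_stick_inj V_law V_indep.
  have itv := ae_stick_itv V_law.
  near=> w; apply: (@rearrangement_strict_mass_partition (stick_breaking (V ^~ w))).
  - by move=> i; apply: stick_breaking_ge0; near: w.
  - by near: w.
  - by near: w.
  - by near: w.
move=> [N [mN N0 SN]]; exists (L @^-1` ~` @strict_mass_partition R); split => //.
- by rewrite -[_ @^-1` _]setTI; apply: mL => //; exact: measurableC.
- have := LL0 _ (measurableC mS); rewrite /distribution /pushforward => <-.
  apply/eqP; rewrite -measure_le0 -N0; apply: le_measure; rewrite ?inE//.
  by rewrite -[_ @^-1` _]setTI; apply: (measurable_funPT L0) => //; exact: measurableC.
Unshelve. all: by end_near. Qed.

End RankedSequence.

(** * The functions representing partition structures *)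
Section ListingProducts.
Variable q : nat.
Implicit Types A : mindex_mset q.

Lemma big_listing (T : Type) (idx : T) (op : Monoid.com_law idx) (F : mindex q -> T) A :
  \big[op/idx]_(h < size (listing A)) F (nth (mzero q) (listing A) h) =
  \big[op/idx]_(a <- finsupp A) iterop (A a) op (F a) idx.
Proof.
rewrite -big_mset -(big_mkord xpredT (fun h => F (nth (mzero q) (listing A) h))).
by rewrite -(big_nth (mzero q) xpredT F); apply: perm_big; rewrite perm_sort.
Qed.

Lemma sum_listing (F : mindex q -> nat) A :
  (\sum_(h < size (listing A)) F (nth (mzero q) (listing A) h) =
   \sum_(a <- finsupp A) A a * F a)%N.
Proof.
rewrite big_listing; apply: eq_bigr => a _.
by rewrite Monoid.iteropE iter_addn_0 mulnC.
Qed.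

Lemma prod_listing (R : comNzRingType) (F : mindex q -> R) A :
  \prod_(h < size (listing A)) F (nth (mzero q) (listing A) h) =
  \prod_(a <- finsupp A) F a ^+ A a.
Proof. by rewrite big_listing. Qed.

Lemma mabs_listing_gt0 n A h : chromatic n A -> (h < size (listing A))%N ->
  (0 < mabs (nth (mzero q) (listing A) h))%N.
Proof.
move=> [A0 _] hA; rewrite lt0n mabs_eq0; apply/eqP => e.
have : mzero q \in listing A by rewrite -e mem_nth.
by rewrite mem_sort in_mset A0.
Qed.

Lemma dustE (m : mindex q) j : dust m (mdelta j) = m j.
Proof.
have delta_inj k k' : (mdelta k == mdelta k' :> mindex q) = (k == k').
  apply/eqP/eqP => [/ffunP /(_ k)|->//]; rewrite !ffunE eqxx.
  by case: eqP.
rewrite /dust (big_morph (fun B : mindex_mset q => B (mdelta j))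
  (id1 := 0%N) (op1 := addn)) => [|B C|]; last 2 first.
- by rewrite msetE2.
- by rewrite mset0E.
rewrite (bigD1 j)//= msetnxx big1 ?addn0// => k kj.
by rewrite msetnE delta_inj eq_sym (negPf kj).
Qed.

Lemma dust0 : dust (mzero q) = mset0.
Proof.
apply: (big_ind (fun B : mindex_mset q => B = mset0)) => // [_ _ -> ->|j _].
  by rewrite msetD0.
by rewrite ffunE msetn0.
Qed.

(** The entry [m j] of the dust is bounded by the number of singletons of colour
    [j]. *)
Lemma finite_dust_le A : finite_set [set m : mindex q | msubset (dust m) A].
Proof.
pose K := \max_(j < q) A (mdelta j).
pose lift (g : {ffun 'I_q -> 'I_K.+1}) : mindex q := [ffun j => val (g j)].
apply: (@sub_finite_set _ _ (lift @` setT)); last exact: finite_image.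
move=> m /= mA; exists [ffun j => inord (m j)] => //.
apply/ffunP => j; rewrite !ffunE /= inordK// ltnS -dustE.
apply: leq_trans (leq_bigmax j).
have [jd|] := boolP (mdelta j \in finsupp (dust m)).
  by have /forallP /(_ [` jd]%fset) := mA.
by rewrite mem_finsupp negbK => /eqP ->.
Qed.

End ListingProducts.

Section AbsolutePsi.
Variables (R : realType) (q : nat).
Implicit Types (x : seq_space 'rV[R]_q) (A : mindex_mset q).
Local Open Scope ereal_scope.

Definition phi_coef A : R :=
  (((weight A)`!)%:R *
    \prod_(a <- finsupp A) (((mfact a)%:R ^+ A a * ((A a)`!)%:R)^-1))%R.

(** On the Kingman simplex these agree with [phi] and [psi]; the absolute values
    make every sum a sum of nonnegative terms everywhere. *)
Definition abs_phi A x : \bar R :=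
  (phi_coef A)%:E *
   \esum_(f in @Tinj (size (listing A)))
      (\prod_(h < size (listing A))
         `|monom (x (f h)) (nth (mzero q) (listing A) h)|)%:E.

Definition abs_psi A x : \bar R :=
  (((weight A)`!)%:R)%:E *
   \sum_(m \in [set m : mindex q | msubset (dust m) A])
     ((`|monom (x 0%N) m|
       / ((mfact m)%:R * ((weight A - mabs m)`!)%:R))%:E
      * abs_phi (msetB A (dust m)) x).

Lemma phi_coef_ge0 A : (0 <= phi_coef A)%R.
Proof. by rewrite mulr_ge0// prodr_ge0. Qed.

Lemma abs_phi_ge0 A x : 0 <= abs_phi A x.
Proof.
rewrite mule_ge0 ?lee_fin ?phi_coef_ge0//.
by apply: esum_ge0 => f _; rewrite lee_fin prodr_ge0.
Qed.

Lemma abs_psi_ge0 A x : 0 <= abs_psi A x.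
Proof.
rewrite mule_ge0 ?lee_fin ?ler0n//; apply: fsume_ge0 => m _.
by rewrite mule_ge0 ?abs_phi_ge0// lee_fin divr_ge0// mulr_ge0 ?ler0n.
Qed.

Lemma abs_phiE A x : (forall i j, (0 <= x i 0 j)%R) -> phi A x = abs_phi A x.
Proof.
move=> x0; rewrite /phi /abs_phi; congr (_ * _); apply: eq_esum => f _.
by congr EFin; apply: eq_bigr => h _; rewrite ger0_norm// monom_ge0.
Qed.

Lemma abs_psiE A x : (forall i j, (0 <= x i 0 j)%R) -> psi A x = abs_psi A x.
Proof.
move=> x0; rewrite /psi /abs_psi; congr (_ * _); apply: eq_fsbigr => m _.
by rewrite abs_phiE// ger0_norm// monom_ge0.
Qed.

Let mmonom i a : measurable_fun setT (fun x : seq_space 'rV[R]_q => `|monom (x i) a|%R : R).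
Proof.
apply: (measurableT_comp (@normr_measurable R setT)).
exact: (measurableT_comp (measurable_monom a) (@measurable_seq_proj _ i)).
Qed.

Lemma measurable_abs_phi A : measurable_fun setT (abs_phi A).
Proof.
apply: measurable_funeM; apply: measurable_esum => [f x|f].
  by rewrite lee_fin prodr_ge0.
by apply/measurable_EFinP; apply: measurable_prod => h _; exact: mmonom.
Qed.

Lemma measurable_abs_psi A : measurable_fun setT (abs_psi A).
Proof.
apply: measurable_funeM; apply: emeasurable_fsum => [|m].
  exact: finite_dust_le.
apply: emeasurable_funM; last exact: measurable_abs_phi.
by apply/measurable_EFinP; apply: measurable_funM => //; exact: mmonom.
Qed.

(** Without dust only [m = 0] contributes. *)
Lemma abs_psi_no_dust A x : x 0%N = 0%R -> abs_psi A x = abs_phi A x.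
Proof.
move=> x0; rewrite /abs_psi (@fsbig_uniq_seq _ _ _ _ _ [:: mzero q])//.
- rewrite big_seq1 x0 monom_mzero normr1 mabs0 subn0 dust0 /mfact big1; last first.
    by move=> j _; rewrite ffunE.
  rewrite (_ : msetB A mset0 = A); last by apply/msetP => a; rewrite msetE2 mset0E subn0.
  by rewrite muleA -EFinM mul1r mul1r divff ?mul1e// pnatr_eq0 -lt0n fact_gt0.
- move=> m; rewrite /= inE => /eqP ->; rewrite dust0.
  by apply/forallP => a; rewrite mset0E.
- move=> m _; rewrite inE => m0.
  have [j mj] : exists j, m j != 0%N.
    apply/not_existsP => h; move/eqP: m0; apply; apply/ffunP => j; rewrite ffunE.
    by apply/eqP; have /negP := h j; rewrite negbK.
  by rewrite x0 /monom (bigD1 j)//= mxE expr0n (negPf mj) mul0r normr0 mul0r mul0e.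
Qed.

Lemma monomZ (c : R) (u : 'rV[R]_q) a :
  (monom (c *: u) a = c ^+ mabs a * monom u a)%R.
Proof.
rewrite /monom /mabs -prodrXr -big_split/=; apply: eq_bigr => j _.
by rewrite mxE exprMn.
Qed.

(** The blocks of a polychromatic sequence factor into a size and a colour. *)
Lemma abs_phi_polychromatic A (l : nat -> R) (p : nat -> 'rV[R]_q) :
  let a h := nth (mzero q) (listing A) h in
  abs_phi A (polychromatic_sequence l p) =
  (phi_coef A)%:E *
   \esum_(f in [set f : {ffun 'I_(size (listing A)) -> nat} | injective f])
     ((\prod_(h < size (listing A)) `|l (f h)| ^+ mabs (a h))%:E *
      (\prod_(h < size (listing A)) `|monom (p (f h)) (a h)|)%:E).
Proof.
rewrite /abs_phi /=; congr (_ * _); set r := size _.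
rewrite (reindex_esum [set f : {ffun 'I_r -> nat} | injective f] _
  (fun f : {ffun 'I_r -> nat} => [ffun h => (f h).+1])).
  apply: eq_esum => f _; rewrite -EFinM -big_split/=; congr EFin.
  by apply: eq_bigr => h _; rewrite ffunE /= monomZ normrM normrX.
split.
- move=> f finj; split=> [h h'|h]; rewrite !ffunE//.
  by move=> [] /finj.
- move=> f g _ _ /ffunP fg; apply/ffunP => h; have := fg h.
  by rewrite !ffunE => -[].
- move=> f [finj f1]; exists [ffun h => (f h).-1].
    move=> h h'; rewrite !ffunE => e; apply: finj.
    by rewrite -(prednK (f1 h)) e prednK.
  by apply/ffunP => h; rewrite !ffunE prednK.
Qed.

End AbsolutePsi.

(** * Representation by the polychromatic Poisson-Dirichlet measure *)
Section Representation.
Variables (R : realType) (q : nat) (theta : R) (nu : probability (borel 'rV[R]_q) R).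
Hypothesis theta_gt0 : 0 < theta.
Hypothesis nu_simplex : nu (@simplex R q) = 1%E.

Let block (A : mindex_mset q) h := nth (mzero q) (listing A) h.

(** Each block contributes [(|a| - 1)! / a!], which is the multinomial coefficient
    divided by [|a|]. *)
Lemma pESF_block_moment n A : chromatic n A ->
  phi_coef R A *
    block_moment theta (fun h : 'I_(size (listing A)) => mabs (block A h)) [set: 'I_(size (listing A))] *
    \prod_(h < size (listing A)) moment nu (block A h) = pESF theta nu n A.
Proof.
move=> cA; have [A0 An] := cA.
rewrite /block_moment cardsT card_ord.
have -> : msize (fun h : 'I_(size (listing A)) => mabs (block A h)) [set: 'I_(size (listing A))] = n.
  rewrite /msize -An /weight -(sum_listing (@mabs q)).
  by apply: eq_bigl => h; rewrite finset.in_setT.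
rewrite (eq_bigl xpredT); last by move=> h; rewrite finset.in_setT.
pose G a : R := theta * ((mabs a).-1`!)%:R * moment nu a.
transitivity (n`!%:R / rising theta n *
    (\prod_(a <- finsupp A) (((mfact a)%:R ^+ A a * ((A a)`!)%:R)^-1) *
     \prod_(h < size (listing A)) G (block A h))).
  rewrite /G /phi_coef An !big_split/= prodr_const card_ord.
  move: (\prod_(_ <- _) _) (\prod_(_ < _) _) (\prod_(_ < _) _) (_ ^+ _) (rising _ _)^-1 (_%:R).
  by move=> *; lra.
rewrite (prod_listing G) -big_split /pESF/=; congr (_ * _).
rewrite big_seq [RHS]big_seq; apply: eq_bigr => a aA.
have a0 : (0 < mabs a)%N.
  by rewrite lt0n mabs_eq0; apply: contraTneq aA => ->; rewrite mem_finsupp A0.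
rewrite invfM mulrAC mulrC -exprVn -exprMn; congr (_ * _ ^+ _).
rewrite /G -{3}(prednK a0) factS natrM prednK//.
have m0 : (mabs a)%:R != 0 :> R by rewrite pnatr_eq0 -lt0n.
transitivity ((mfact a)%:R^-1 * theta * ((mabs a).-1`!)%:R * moment nu a * ((mabs a)%:R / (mabs a)%:R)).
  by rewrite divff// mulr1; lra.
by move: (((mabs a).-1`!)%:R) ((mabs a)%:R) ((mfact a)%:R^-1) ((mabs a)%:R^-1) => *; lra.
Qed.

Context {d} {Omega : measurableType d}.
Variables (P : probability Omega R) (L : {RV P >-> seq_space R}).
Variables (p : {RV P >-> seq_space 'rV[R]_q}).
Hypothesis L_law : poisson_dirichlet theta (distribution P L).
Hypothesis p_law : forall i, has_law P (fun w => p w i : borel 'rV[R]_q) nu.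
Hypothesis p_indep : mutually_independent P (fun i w => p w i : borel 'rV[R]_q).
Hypothesis Lp_indep : independent2 P L p.

Let mp i : measurable_fun setT (fun w => p w i : borel 'rV[R]_q).
Proof. exact: (measurableT_comp (@measurable_seq_proj _ i) (measurable_funPT p)). Qed.

Let mnorm_monom a : measurable_fun setT (fun u : borel 'rV[R]_q => `|monom u a| : R).
Proof.
apply: (measurableT_comp (@normr_measurable R setT)); exact: measurable_monom.
Qed.

Local Open Scope ereal_scope.

(** Distinct blocks are coloured independently, with colours of the same law whatever
    indices [f] selects. *)
Lemma expectation_colours r (a : 'I_r -> mindex q) (f : {ffun 'I_r -> nat}) :
  injective f ->
  \int[P]_w (\prod_(h < r) `|monom (p w (f h)) (a h)|)%:E =
  (\prod_(h < r) moment nu (a h))%:E.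
Proof.
move=> finj; pose N := (\max_h f h).+1.
have fN h : (f h < N)%N by rewrite ltnS leq_bigmax.
(* An injective [f] puts at most one factor at each index, and grouping the
   factors by index makes independence applicable. *)
have group (F : 'I_r -> nat -> R) : (\prod_(h < r) F h (f h) =
    \prod_(i < N) \prod_(h < r | f h == i) F h i)%R.
  rewrite (exchange_big_dep xpredT)//=; apply: eq_bigr => h _.
  by rewrite (big_pred1 (Ordinal (fN h))).
pose g i (u : borel 'rV[R]_q) : \bar R := (\prod_(h < r | f h == i) `|monom u (a h)|)%:E.
transitivity (\int[P]_w \prod_(i < N) g i (p w i)).
  apply: eq_integral => w _; rewrite /g prodEFin; congr EFin.
  exact: (group (fun h i => `|monom (p w i) (a h)|%R)).
rewrite (@expectation_prod_independent _ _ _ P _ (borel 'rV[R]_q) (fun i w => p w i) g N)//.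
- rewrite (group (fun h _ => moment nu (a h))) -prodEFin; apply: eq_bigr => i _.
  have Eg : \int[P]_w g i (p w i) = \int[nu]_u g i u.
    apply: (@integral_same_law _ _ (borel 'rV[R]_q) _ _ _ _ P nu (fun w => p w i) id) => //.
    + by move=> B mB; exact: p_law.
    + apply/measurable_EFinP; rewrite (_ : (fun u => _) = (fun u =>
        \prod_(h <- [seq h <- enum 'I_r | f h == i]) `|monom u (a h)|)%R).
        by apply: measurable_prod => h _; exact: mnorm_monom.
      by apply/funext => u; rewrite big_filter big_enum_cond.
    + by move=> u; rewrite lee_fin prodr_ge0.
  rewrite Eg /g; have [[h fh]|nofh] := pselect (exists h, f h = i).
    have Ph h' : (f h' == i) = (h' == h).
      by apply/eqP/eqP => [|->//]; rewrite -fh => /finj.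
    rewrite (big_pred1 h)//; under eq_integral do rewrite (big_pred1 h)//.
    exact: integral_norm_monom.
  have Ph h' : (f h' == i) = false.
    by apply/negP => /eqP e; apply: nofh; exists h'.
  rewrite big_pred0//; under eq_integral do rewrite big_pred0//.
  by rewrite integral_cst// mul1e; exact: probability_setT.
- move=> i; apply/measurable_EFinP.
  rewrite (_ : (fun u => _) = (fun u =>
        \prod_(h <- [seq h <- enum 'I_r | f h == i]) `|monom u (a h)|)%R).
    by apply: measurable_prod => h _; exact: mnorm_monom.
  by apply/funext => u; rewrite big_filter big_enum_cond.
- by move=> i u; rewrite lee_fin prodr_ge0.
Qed.

(** By independence of sizes and colours, the sum over injections factors into the
    moments of [nu] and the correlation function of the sizes. *)
Lemma expectation_abs_phi n A : chromatic n A ->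
  \int[P]_w abs_phi A (polychromatic_sequence (L w) (p w)) = (pESF theta nu n A)%:E.
Proof.
move=> cA; set r := size (listing A); pose a (h : 'I_r) := block A h.
have n_gt0 (h : 'I_r) : (0 < mabs (a h))%N by exact: mabs_listing_gt0 cA _.
pose F (f : {ffun 'I_r -> nat}) (l : seq_space R) : \bar R :=
  (\prod_(h < r) `|l (f h)| ^+ mabs (a h))%:E.
pose H (f : {ffun 'I_r -> nat}) (u : seq_space 'rV[R]_q) : \bar R :=
  (\prod_(h < r) `|monom (u (f h)) (a h)|)%:E.
have F0 f l : 0 <= F f l by rewrite lee_fin prodr_ge0.
have H0 f u : 0 <= H f u by rewrite lee_fin prodr_ge0.
have mF f : measurable_fun setT (F f).
  apply/measurable_EFinP; apply: measurable_prod => h _; apply: measurable_funX.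
  by apply: (measurableT_comp (@normr_measurable R setT)); exact: measurable_seq_coord.
have mH f : measurable_fun setT (H f).
  apply/measurable_EFinP; apply: measurable_prod => h _.
  exact: (measurableT_comp (mnorm_monom (a h)) (@measurable_seq_proj _ (f h))).
have mFL f : measurable_fun setT (fun w => F f (L w)).
  exact: (measurableT_comp (mF f) (measurable_funPT L)).
have mHp f : measurable_fun setT (fun w => H f (p w)).
  exact: (measurableT_comp (mH f) (measurable_funPT p)).
under eq_integral do rewrite abs_phi_polychromatic.
have mFH f : measurable_fun setT (fun w => F f (L w) * H f (p w)).
  exact: emeasurable_funM.
have FH0 f w : 0 <= F f (L w) * H f (p w) by rewrite mule_ge0.
rewrite ge0_integralZl//; last 3 first.
- by apply: measurable_esum => [f w|f]; [exact: FH0|exact: mFH].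
- by move=> w _; apply: esum_ge0 => f _; exact: FH0.
- by rewrite lee_fin phi_coef_ge0.
rewrite integral_esum; last 2 first.
- by move=> f w; exact: FH0.
- by move=> f; exact: mFH.
pose M := (\prod_(h < r) moment nu (a h))%R.
have M0 : (0 <= M)%R by apply: prodr_ge0 => h _; exact: moment_ge0.
rewrite (eq_esum (b := fun f => M%:E * \int[P]_w F f (L w))); last first.
  move=> f finj; rewrite (@expectation_independent2 _ _ _ P _ _ _ _ L p (F f) (H f))//.
  - by rewrite (expectation_colours _ finj) muleC.
rewrite esumZl//; last by move=> f; exact: integral_ge0.
rewrite -integral_esum//.
have := expectation_block_sum theta_gt0 L_law n_gt0.
rewrite /block_sum => ->.
by rewrite -!EFinM -(pESF_block_moment cA); congr EFin; rewrite -mulrA [(M * _)%R]mulrC.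
Qed.

Variable X : {RV P >-> seq_space 'rV[R]_q}.
Hypothesis XE : forall w, X w = polychromatic_sequence (L w) (p w).

(** Strict monotonicity of the masses leaves no tie to be broken by colours. *)
Lemma polychromatic_nabla (l : nat -> R) (u : nat -> 'rV[R]_q) :
  strict_mass_partition l -> (forall i, simplex (u i)) ->
  nabla (polychromatic_sequence l u).
Proof.
move=> [l0 ll l1] us.
have vabsE k : vabs (l k *: u k) = l k.
  rewrite /vabs; under eq_bigr do rewrite mxE normrM.
  by rewrite -mulr_sumr -/(vabs _) (us k).2 mulr1 ger0_norm.
split.
- move=> [|i] j /=; rewrite mxE// mulr_ge0//.
  by have [/(_ j)/andP[]] := us i.
- move=> [//|i] _; rewrite /vsl_le /vsl_key /= Order.SeqLexiOrder.lexi_cons !vabsE.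
  by rewrite (ltW (ll i))/= leNgt ll.
- rewrite nneseries_esumT; last by move=> k; rewrite lee_fin sumr_ge0.
  rewrite (@esumID _ _ (range succn)); last by move=> k _; rewrite lee_fin sumr_ge0.
  rewrite !setTI [X in _ + X]esum1 ?adde0; last first.
    move=> [_|k []]; last by exists k.
    by rewrite /vabs big1// => j _; rewrite mxE normr0.
  rewrite (reindex_esum setT _ succn)//; last by split=> // i j _ _ [].
  by rewrite -l1; apply: eq_esum => k _; rewrite /= vabsE ger0_norm.
Qed.

Lemma ae_polychromatic_nabla : {ae P, forall w, nabla (X w)}.
Proof.
have simp i : {ae P, forall w, simplex (p w i)}.
  exists ((fun w => p w i : borel 'rV[R]_q) @^-1` ~` (@simplex R q)); split=> //.
    by rewrite -[_ @^-1` _]setTI; apply: mp => //; apply: measurableC; exact: measurable_simplex.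
  rewrite p_law; last by apply: measurableC; exact: measurable_simplex.
  by rewrite probability_setC; [rewrite nu_simplex subee|exact: measurable_simplex].
have simps := ae_foralln simp.
have Lw := ae_strict_mass_partition theta_gt0 L_law.
near=> w; rewrite XE; apply: polychromatic_nabla; first by near: w.
by near: w.
Unshelve. all: by end_near. Qed.

Variable Pi : probability (seq_space 'rV[R]_q) R.
Hypothesis X_law : has_law P X Pi.

(** Almost surely the sequence lies in the simplex, where [psi] coincides with
    [abs_psi], so that the restriction to the simplex can be dropped. *)
Lemma pESF_representation : represented_by (pESF theta nu) Pi.
Proof.
move=> n A cA; pose g := abs_psi A \_ (@nabla R q : set (seq_space 'rV[R]_q)).
have mn := @measurable_nabla R q.
have mg : measurable_fun setT g.
  by apply/(measurable_restrictT _ mn); apply: measurable_funTS; exact: measurable_abs_psi.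
have mX : measurable_fun setT (X : Omega -> seq_space 'rV[R]_q) := measurable_funPT X.
transitivity (\int[Pi]_x g x); last first.
  rewrite -integral_mkcond; apply: eq_integral => x; rewrite inE => -[x0 _ _].
  by rewrite abs_psiE.
have g0 x : 0 <= g x by apply: erestrict_ge0 => y _; exact: abs_psi_ge0.
have <- : \int[P]_w g (X w) = \int[Pi]_x g x.
  exact: (@integral_same_law _ _ (seq_space 'rV[R]_q) _ _ _ _ P Pi X id).
rewrite -(expectation_abs_phi cA); apply: ge0_ae_eq_integral => //.
- rewrite (_ : (fun w => _) = (fun w => abs_phi A (X w))); last by apply/funext => w; rewrite XE.
  exact: (measurableT_comp (@measurable_abs_phi R q A) mX).
- exact: (measurableT_comp mg mX).
- by move=> w _; exact: abs_phi_ge0.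
apply: filterS ae_polychromatic_nabla => w Xw _.
by rewrite /g patchE mem_set// abs_psi_no_dust XE.
Qed.

End Representation.

Theorem proposition5p43 (R : realType) (q : nat) (q_ge1 : (1 <= q)%N)
    (theta : R) (theta_gt0 : 0 < theta)
    (nu : probability (borel 'rV[R]_q) R)
    (nu_simplex : nu (@simplex R q) = 1%E) :
  partition_structure (pESF theta nu) /\
  forall Pi : probability (seq_space 'rV[R]_q) R,
    polychromatic_PD theta nu Pi -> represented_by (pESF theta nu) Pi.
Proof.
split; first exact: pESF_partition_structure.
move=> Pi [d0 [Om0 [P0 [L0 [p0 [X0 []]]]]]] L_law [p_law p_indep] Lp_indep XE X_law.
exact: (pESF_representation theta_gt0 nu_simplex L_law p_law p_indep Lp_indep XE X_law).
Qed.
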